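(* Let $\mathcal{M}\subseteq\mathbb{R}^{m\times n}$ be an embedded Riemannian manifold and let $\Phi(\Theta)=-\mathbb{E}_{P_x}\big[\mathbb{E}_{P_{y|x}(\Theta)}\log p(y|f(x,\Theta))\big]$. Then for any second-order retraction $R$ on $\mathcal{M}$, the steepest descent direction in the tangent space to $\mathcal{M}$ at $\Theta$ (with vectorization $\theta$) is given by $-d^R(\theta)$, where $d^R(\theta)=(F^R(\theta))^{-1}\,\mathrm{grad}\,\Phi(\theta)$, in the sense that $$\frac{-d^R(\theta)}{\|\mathrm{grad}\,\Phi(\theta)\|_{(F^R(\theta))^{-1}}}=\lim_{\epsilon\to 0}\frac1\epsilon\ \operatorname*{arg\,min}_{d\in T_\theta\mathcal{M}:\ \mathbb{E}_{P_x}\left[\mathrm{KL}\left(P_{y|x}(R_\theta(d))\,\|\,P_{y|x}(\theta)\right)\right]\le \epsilon^2/2}\ \Phi(R_\theta(d)),$$ where $\|\mathrm{grad}\,\Phi(\theta)\|_{(F^R(\theta))^{-1}}=\sqrt{\mathrm{grad}\,\Phi(\theta)^\top (F^R(\theta))^{-1}\,\mathrm{grad}\,\Phi(\theta)}$.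
   Context: Matrices $\Theta\in\mathbb{R}^{m\times n}$ are identified with their vectorizations $\theta=\mathrm{vec}(\Theta)\in\mathbb{R}^{r}$, $r=mn$; $T_\theta\mathcal{M}$ is the tangent space at $\Theta$, viewed (by vectorization) as a subspace of $\mathbb{R}^r$, and $\mathcal{M}$ carries the metric induced from the Euclidean inner product. $\mathrm{grad}$ denotes the Riemannian gradient (orthogonal projection of the Euclidean gradient onto $T_\theta\mathcal{M}$), with respect to $\theta$. Statistical model: $f(\cdot,\Theta):\mathcal{X}\to\mathcal{Y}$ is a parametrized map from the input space to the output space; $p(y|z)$ is a conditional density; $P_{y|x}(\Theta):=P_{y|f(x,\Theta)}$ is the distribution of $y$ with density $p(\cdot|f(x,\Theta))$; $P_x$ is a distribution on $\mathcal{X}$. Regularity conditions allowing expectation and differentiation with respect to the parameter to be interchanged are assumed throughout. $\mathrm{KL}(\cdot\|\cdot)$ is the Kullback–Leibler divergence. Riemannian Fisher information matrix: $$F^R(\theta):=\mathbb{E}_{P_x}\Big[\mathbb{E}_{P_{y|x}(\theta)}\big[\mathrm{grad}\log p(y|f(x,\theta))\ \mathrm{grad}\log p(y|f(x,\theta))^\top\big]\Big]\in\mathbb{R}^{r\times r}.$$ $F^R(\theta)$ is regarded as a linear operator $T_\theta\mathcal{M}\to T_\theta\mathcal{M}$, assumed positive definite there, and $(F^R(\theta))^{-1}$ denotes its inverse on $T_\theta\mathcal{M}$. A retraction is a smooth map $R:T\mathcal{M}=\bigcup_\Theta T_\Theta\mathcal{M}\to\mathcal{M}$ with $R_\Theta(0)=\Theta$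 and $\frac{d}{dt}R_\Theta(t\xi)|_{t=0}=\xi$ for all $\xi\in T_\Theta\mathcal{M}$. It is a second-order retraction if moreover $\mathcal{P}_{T_\Theta\mathcal{M}}\big(\frac{d^2}{dt^2}R_\Theta(t\xi)|_{t=0}\big)=0$ for all $\Theta\in\mathcal{M}$, $\xi\in T_\Theta\mathcal{M}$, where $\mathcal{P}_{T_\Theta\mathcal{M}}$ is the orthogonal projection onto $T_\Theta\mathcal{M}$.
   Formalization: The arg min over all tangent d can fail to converge (unit circle, exponential map: d+2πk is also feasible), so the limit is proved for |d|<ρ, every small ρ>0, and for all d if the feasible sets shrink to 0; ε→0 means ε→0+, and grad Φ(θ)≠0 is assumed. *)

(* Defs.v *)
From HB Require Import structures.
From mathcomp Require Import all_boot all_order all_algebra.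
From mathcomp Require Import all_classical all_reals all_analysis.

Set Implicit Arguments.
Unset Strict Implicit.
Unset Printing Implicit Defensive.

Import Order.TTheory GRing.Theory Num.Theory.
Import numFieldNormedType.Exports.

Local Open Scope classical_set_scope.
Local Open Scope ring_scope.

(* vec stacks the columns of A; mxvec alone would stack the rows. *)
Definition vec (R : realType) m n (A : 'M[R]_(m, n)) : 'cV[R]_(n * m) :=
  (mxvec A^T)^T.

Definition unvec (R : realType) m n (v : 'cV[R]_(n * m)) : 'M[R]_(m, n) :=
  (vec_mx v^T)^T.

Section euclidean.
Context {R : realType} {r : nat}.
Implicit Types (u v w : 'cV[R]_r) (T : set 'cV[R]_r).

Definition dotv u v : R := (u^T *m v) 0 0.

(* The orthogonal projection of v onto T, for T a linear subspace. *)
Definition oproj T v : 'cV[R]_r :=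
  xget 0 [set u | T u /\ forall w, T w -> dotv (v - u) w = 0].

(* The inverse of F as an operator T -> T, for T a linear subspace on which
   F is invertible. *)
Definition inv_on T (F : 'M[R]_r) v : 'cV[R]_r :=
  xget 0 [set u | T u /\ F *m u = v].

Definition posdef_on T (F : 'M[R]_r) : Prop :=
  forall u, T u -> u != 0 -> 0 < dotv u (F *m u).

End euclidean.

Section smoothness.
Context {R : realType}.

(* g is C^k on the open set A of a finite-dimensional space. *)
Fixpoint Cn_on (k : nat) (V W : normedModType R) (A : set V) (g : V -> W)
    : Prop :=
  match k with
  | 0 => forall x, A x -> {for x, continuous g}
  | k'.+1 => (forall x, A x -> differentiable g x) /\
             (forall v, Cn_on k' A (fun x => 'D_v g x))
  end.

Definition smooth_on (V W : normedModType R) (A : set V) (g : V -> W) : Prop :=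
  forall k, Cn_on k A g.

(* Smoothness on an arbitrary subset S: local smooth extensions exist. *)
Definition smooth_on_subset (V W : normedModType R) (S : set V) (g : V -> W)
    : Prop :=
  forall x, S x -> exists (A : set V) (h : V -> W),
    [/\ open_nbhs x A, smooth_on A h & forall y, S y -> A y -> h y = g y].

End smoothness.

Section manifold.
Context {R : realType} {m n : nat}.
Local Notation mat := 'M[R]_(m, n).
Local Notation r := (n * m)%N.
Implicit Types (M : set mat) (Theta xi : mat) (Rt : mat -> mat -> mat).

(* Local slice condition: near each of its points M is straightened by a
   diffeomorphism phi of open sets onto the vanishing of the coordinates
   of index >= k, where k is the dimension of M. *)
Definition embedded_submanifold M : Prop :=
  exists k : nat, (k <= r)%N /\
    forall Theta, M Theta ->
    exists (A : set mat) (B : set 'cV[R]_r)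
           (phi : mat -> 'cV[R]_r) (psi : 'cV[R]_r -> mat),
      [/\ open_nbhs Theta A /\ open B,
          smooth_on A phi /\ smooth_on B psi,
          forall x, A x -> B (phi x) /\ psi (phi x) = x,
          forall z, B z -> A (psi z) /\ phi (psi z) = z
        & forall x, A x ->
            (M x <-> forall i : 'I_r, (k <= i)%N -> phi x i 0 = 0)].

Definition tangent M Theta : set mat :=
  [set xi | exists (I : set R) (c : R -> mat),
    [/\ open_nbhs 0 I, smooth_on I c, forall t, I t -> M (c t), c 0 = Theta
      & derive1 c 0 = xi]].

Definition tangentv M Theta : set 'cV[R]_r := @vec R m n @` tangent M Theta.

Definition tangent_bundle M : set (mat * mat) :=
  [set z | M z.1 /\ tangent M z.1 z.2].

(* Rt Theta xi is only meaningful for (Theta, xi) in the tangent bundle. *)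
Definition retraction M Rt : Prop :=
  [/\ smooth_on_subset (tangent_bundle M) (fun z : mat * mat => Rt z.1 z.2),
      forall Theta xi, M Theta -> tangent M Theta xi -> M (Rt Theta xi),
      forall Theta, M Theta -> Rt Theta 0 = Theta
    & forall Theta xi, M Theta -> tangent M Theta xi ->
        derive1 (fun t : R => Rt Theta (t *: xi)) 0 = xi].

Definition second_order_retraction M Rt : Prop :=
  retraction M Rt /\
  forall Theta xi, M Theta -> tangent M Theta xi ->
    oproj (tangentv M Theta)
      (vec (derive1n 2 (fun t : R => Rt Theta (t *: xi)) 0)) = 0.

(* Euclidean gradient with respect to theta = vec Theta. *)
Definition egrad (phi : mat -> R) Theta : 'cV[R]_r :=
  \col_k 'D_(unvec (delta_mx k 0)) phi Theta.

Definition rgrad M (phi : mat -> R) Theta : 'cV[R]_r :=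
  oproj (tangentv M Theta) (egrad phi Theta).

End manifold.

(* KL(P || Q) = E_P[log dP/dQ], and +oo when P is not dominated by Q. *)
Definition KL (R : realType) d (T : measurableType d) (P Q : probability T R)
    : \bar R :=
  if `[< P `<< Q >] then
    (\int[P]_y (ln (fine (Radon_Nikodym (charge_of_finite_measure P) Q y)))%:E)%E
  else +oo%E.

(* cond_dens y z is p(y|z), a density with respect to the reference measure
   base; cond_prob z is P_{y|z}. *)
Record stat_model (R : realType) (dX dY : measure_display)
    (X : measurableType dX) (Y : measurableType dY) (m n : nat) := StatModel {
  input_prob : probability X R ;
  predictor : X -> 'M[R]_(m, n) -> Y ;
  base : {sigma_finite_measure set Y -> \bar R} ;
  cond_dens : Y -> Y -> R ;
  cond_prob : Y -> probability Y R ;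
  cond_dens_ge0 : forall y z, 0 <= cond_dens y z ;
  measurable_cond_dens : forall z, measurable_fun [set: Y] (cond_dens ^~ z) ;
  cond_probE : forall z (A : set Y), measurable A ->
    cond_prob z A = (\int[base]_(y in A) (cond_dens y z)%:E)%E }.

Section model.
Context {R : realType} {dX dY : measure_display}.
Context {X : measurableType dX} {Y : measurableType dY} {m n : nat}.
Variable S : stat_model R X Y m n.
Local Notation mat := 'M[R]_(m, n).
Local Notation r := (n * m)%N.
Local Notation Px := (input_prob S).
Local Notation nu := (base S).
Implicit Types (Theta : mat) (M : set mat).

Definition Pyx Theta (x : X) : probability Y R :=
  cond_prob S (predictor S x Theta).

Definition dens (x : X) (y : Y) Theta : R :=
  cond_dens S y (predictor S x Theta).

Definition logdens (x : X) (y : Y) Theta : R := ln (dens x y Theta).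

(* E_{P_x} [E_{P_{y|x}(Theta)} [g x y]] *)
Definition expect Theta (g : X -> Y -> R) : R :=
  fine (\int[Px]_x \int[Pyx Theta x]_y (g x y)%:E)%E.

Definition Phi Theta : R := - expect Theta (fun x y => logdens x y Theta).

Definition fisher M Theta : 'M[R]_r :=
  \matrix_(i, j) expect Theta (fun x y =>
    (rgrad M (logdens x y) Theta *m (rgrad M (logdens x y) Theta)^T) i j).

Definition expected_KL Theta1 Theta0 : \bar R :=
  (\int[Px]_x KL (Pyx Theta1 x) (Pyx Theta0 x))%E.

Definition integrated (h : X -> Y -> mat -> R) Theta : R :=
  fine (\int[Px]_x \int[nu]_y (h x y Theta)%:E)%E.

(* On the open set A, the derivatives in Theta of order at most k of the
   double integral of h exist and are computed under the integral sign. *)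
Fixpoint interchange (k : nat) (A : set mat) (h : X -> Y -> mat -> R) : Prop :=
  (forall Theta, A Theta ->
    (Px \x nu)%E.-integrable setT (fun xy => (h xy.1 xy.2 Theta)%:E)) /\
  match k with
  | 0 => True
  | k'.+1 =>
      [/\ forall x y Theta, A Theta -> differentiable (h x y) Theta,
          forall Theta, A Theta -> differentiable (integrated h) Theta,
          forall v Theta, A Theta ->
            'D_v (integrated h) Theta =
            integrated (fun x y => 'D_v (h x y)) Theta
        & forall v, interchange k' A (fun x y => 'D_v (h x y))]
  end.

(* The regularity conditions at Theta0: near Theta0 the support of the
   densities does not depend on the parameter, and expectation and
   differentiation can be interchanged in the total mass of P_{y|x}, in Phi
   and in the expected divergence from P_{y|x}(Theta0). *)
Definition regular_at Theta0 : Prop :=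
  exists2 A : set mat, open_nbhs Theta0 A &
    [/\ forall x y Theta, A Theta ->
          (0 < dens x y Theta <-> 0 < dens x y Theta0),
        interchange 2 A dens,
        interchange 1 A
          (fun x y Theta => dens x y Theta * logdens x y Theta)
      & interchange 2 A
          (fun x y Theta =>
             dens x y Theta * (logdens x y Theta - logdens x y Theta0))].

End model.

Section arg_min.
Context {R : realType}.

Definition argmin (T : Type) (C : set T) (phi : T -> R) : set T :=
  [set d | C d /\ forall d', C d' -> phi d <= phi d'].

(* l is the limit, as eps -> 0+, of 1/eps times the minimizer of phi over
   C eps. The minimizer need not be unique: minimizers must exist for small
   eps and all of them, rescaled, must approach l. *)
Definition rescaled_argmin_cvg (V : normedModType R) (C : R -> set V)
    (phi : V -> R) (l : V) : Prop :=
  forall W : set V, nbhs l W -> \forall eps \near 0^'+,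
    argmin (C eps) phi !=set0 /\
    (forall d, argmin (C eps) phi d -> W (eps^-1 *: d)).

End arg_min.

Section steepest.
Context {R : realType} {dX dY : measure_display}.
Context {X : measurableType dX} {Y : measurableType dY} {m n : nat}.
Variables (S : stat_model R X Y m n) (M : set 'M[R]_(m, n)).
Variables (Rt : 'M[R]_(m, n) -> 'M[R]_(m, n) -> 'M[R]_(m, n)).
Variable Theta : 'M[R]_(m, n).
Implicit Type D : set 'cV[R]_(n * m).

Definition natural_gradient : 'cV[R]_(n * m) :=
  inv_on (tangentv M Theta) (fisher S M Theta) (rgrad M (Phi S) Theta).

Definition dual_norm : R :=
  Num.sqrt (dotv (rgrad M (Phi S) Theta) natural_gradient).

(* The feasible directions lying in D; D = setT imposes no restriction. A
   bounded D matters when Rt Theta is not injective: for the exponential map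
   of the unit circle, d and d + 2 pi are both feasible for every eps, so the
   global minimizers do not shrink with eps. *)
Definition feasible D (eps : R) : set 'cV[R]_(n * m) :=
  [set d | [/\ D d, tangentv M Theta d
    & (expected_KL S (Rt Theta (unvec d)) Theta <= (eps ^+ 2 / 2)%:E)%E]].

Definition steepest_descent_in D : Prop :=
  rescaled_argmin_cvg (feasible D)
    (fun d => Phi S (Rt Theta (unvec d)))
    (dual_norm^-1 *: (- natural_gradient)).

End steepest.

(* Main.v *)
(** Let [T] be the tangent space, [p] the density and [ell] its logarithm.
    Differentiating under the integral sign, the expected divergence [K] from the
    model at [Theta] vanishes to first order at [Theta], because the total mass
    is constantly 1, and its second derivative is [E (D_v ell * D_w ell)]; on [T]
    this is the quadratic form of the Fisher matrix [F].  A retraction moves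
    [Theta] by [d + o(d)], so on [T]
      [K (R d) = d^T F d / 2 + o(|d|^2)],  [Phi (R d) = Phi Theta + g . d + o(|d|)]
    with [g] the Riemannian gradient.  After rescaling by [eps] the problem tends
    to minimizing [g . w] subject to [w^T F w <= 1], whose only solution is
    [l = - F^-1 g / |g|_(F^-1)].  A rescaled minimizer [w] satisfies
    [w^T F w <= 1 + delta] and, compared with the feasible point
    [(1 - delta) l], also [l^T F w >= 1 - O(delta)]; hence
    [(w - l)^T F (w - l) = O(delta)], and [F] is coercive on [T]. *)

From HB Require Import structures.
Require Import Defs.
From mathcomp Require Import all_boot all_order all_algebra.
From mathcomp Require Import all_classical all_reals all_analysis.
From mathcomp Require Import measurable_realfun ring lra.

Set Implicit Arguments.
Unset Strict Implicit.
Unset Printing Implicit Defensive.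

Import Order.TTheory GRing.Theory Num.Theory.
Import numFieldNormedType.Exports.

Local Open Scope classical_set_scope.
Local Open Scope ring_scope.

(** * Densities and the Kullback-Leibler divergence *)

Section density.
Context {R : realType} {d : measure_display} {T : measurableType d}.
Variable nu : {sigma_finite_measure set T -> \bar R}.
Local Open Scope ereal_scope.

Definition has_density (P : set T -> \bar R) (p : T -> R) :=
  [/\ forall y, (0 <= p y)%R, measurable_fun setT p &
      forall A, measurable A -> P A = \int[nu]_(y in A) (p y)%:E].

Lemma density_dominates (P : {finite_measure set T -> \bar R}) p :
  has_density P p -> P `<< nu.
Proof.
case=> p0 mp PE; apply/null_content_dominatesP => A mA A0.
rewrite PE// null_set_integral//.
by apply/measurable_EFinP; exact: measurable_funTS.
Qed.

Lemma ge0_integral_density (P : {finite_measure set T -> \bar R}) p E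
    (f : T -> \bar R) :
  has_density P p -> measurable E -> measurable_fun setT f ->
  (forall y, 0 <= f y) ->
  \int[P]_(y in E) f y = \int[nu]_(y in E) (f y * (p y)%:E).
Proof.
move=> dP mE mf f0; have [p0 mp PE] := dP.
have domP := density_dominates dP.
rewrite -(Radon_Nikodym_SigmaFinite.change_of_variables domP)//; last first.
  exact: measurable_funTS.
have mRN := measurable_int _ (Radon_Nikodym_SigmaFinite.f_integrable domP).
have mp' : measurable_fun setT (EFin \o p) by exact/measurable_EFinP.
apply: ge0_ae_eq_integral => //.
- by apply: measurable_funTS; exact: emeasurable_funM.
- by apply: measurable_funTS; exact: emeasurable_funM.
- by move=> y _; rewrite mule_ge0// Radon_Nikodym_SigmaFinite.f_ge0.
- by move=> y _; rewrite mule_ge0// lee_fin.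
- apply: ae_eqe_mul2l; apply: integral_ae_eq => //.
  + apply: (integrableS measurableT) => //.
    exact: Radon_Nikodym_SigmaFinite.f_integrable.
  + exact: measurable_funTS.
  + by move=> A AE mA; rewrite -Radon_Nikodym_SigmaFinite.f_integral// PE.
Qed.

Lemma integral_density (P : {finite_measure set T -> \bar R}) p
    (f : T -> R) :
  has_density P p -> measurable_fun setT f ->
  \int[P]_y (f y)%:E = \int[nu]_y (p y * f y)%:E.
Proof.
move=> dP mf; have [p0 mp PE] := dP.
have mf' : measurable_fun setT (EFin \o f) by exact/measurable_EFinP.
rewrite integralE [RHS]integralE; congr (_ - _).
- rewrite (ge0_integral_density dP)//; last exact: measurable_funepos.
  apply: eq_integral => y _; rewrite !funeposE -!EFin_max -EFinM.
  by rewrite maxr_pMl// mul0r mulrC.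
- rewrite (ge0_integral_density dP)//; last exact: measurable_funeneg.
  apply: eq_integral => y _; rewrite !funenegE -!EFinN -!EFin_max -EFinM.
  by rewrite maxr_pMl// mul0r mulNr mulrC.
Qed.

Lemma measurable_inv_ge0 (p : T -> R) : (forall y, (0 <= p y)%R) ->
  measurable_fun setT p -> measurable_fun setT (fun y => (p y)^-1)%R.
Proof.
move=> p0 mp; rewrite (_ : (fun y => _) = (@powR R ^~ (-1)) \o p)%R.
  exact: measurableT_comp (measurable_powR _) mp.
by apply/funext => y /=; rewrite powR_inv1.
Qed.

Lemma KL_density (P Q : probability T R) p q :
  has_density P p -> has_density Q q ->
  (forall y, 0 < p y <-> 0 < q y)%R ->
  KL P Q = \int[nu]_y (p y * (ln (p y) - ln (q y)))%:E.
Proof.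
move=> dP dQ pq; have [p0 mp PE] := dP; have [q0 mq QE] := dQ.
have pq0 y : q y = 0%R -> p y = 0%R.
  move=> qy; apply/eqP; rewrite eq_le p0 andbT leNgt; apply/negP.
  by move/pq; rewrite qy ltxx.
have mr : measurable_fun setT (fun y => p y / q y)%R.
  by apply: measurable_funM => //; exact: measurable_inv_ge0.
have mr' : measurable_fun setT (fun y => (p y / q y)%:E).
  exact/measurable_EFinP.
have rE A : measurable A -> \int[Q]_(y in A) (p y / q y)%:E = P A.
  move=> mA; rewrite (ge0_integral_density dQ)//; last first.
    by move=> y; rewrite lee_fin divr_ge0.
  rewrite PE//; apply: eq_integral => y _; rewrite -EFinM.
  have [qy|qy] := eqVneq (q y) 0%R; first by rewrite qy mulr0 pq0.
  by rewrite divfK.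
have PQ : P `<< Q.
  apply/null_content_dominatesP => A mA QA.
  rewrite -[LHS]rE// null_set_integral//.
  exact: measurable_funTS.
rewrite /KL; case: asboolP => // _.
rewrite -(integral_density (f := fun y => ln (p y) - ln (q y))%R dP); last first.
  by apply: measurable_funB; apply: measurableT_comp => //; exact: measurable_ln.
have mRN : measurable_fun setT (Radon_Nikodym (charge_of_finite_measure P) Q).
  exact: (measurable_int _ (Radon_Nikodym_integrable _)).
apply: ae_eq_integral => //.
- apply/measurable_EFinP; apply: measurableT_comp; first exact: measurable_ln.
  exact: measurableT_comp.
- apply/measurable_EFinP.
  by apply: measurable_funB; apply: measurableT_comp => //; exact: measurable_ln.
have H1 : ae_eq P setT (Radon_Nikodym (charge_of_finite_measure P) Q)
    (fun y => (p y / q y)%:E).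
  apply: (null_dominates_ae_eq _ PQ) => //; apply: integral_ae_eq => //.
    exact: Radon_Nikodym_integrable.
  by move=> A _ mA; rewrite rE// -Radon_Nikodym_integral.
have H2 : {ae P, forall y, p y != 0%R}.
  have mp0 : measurable [set y | p y = 0%R].
    by rewrite -[X in measurable X]setTI; exact: (mp measurableT _ (measurable_set1 0%R)).
  exists [set y | p y = 0%R]; split => //.
  - rewrite -[LHS]/(P [set y | p y = 0%R]) PE//.
    by apply: integral0_eq => y /= ->.
  - by move=> y /= /negP; rewrite negbK => /eqP.
apply: filterS2 H1 H2 => y /= H1 py _.
have py0 : (0 < p y)%R by rewrite lt_neqAle eq_sym py p0.
by rewrite H1//= ln_div// posrE//; exact/pq.
Qed.

End density.

(** * Orthogonal projectors and quadratic forms on a subspace *)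

Section dotv.
Context {R : realType} {r : nat}.
Implicit Types (u v w : 'cV[R]_r) (a : R) (F P : 'M[R]_r).

Lemma dotvE u v : dotv u v = \sum_i u i 0 * v i 0.
Proof. by rewrite /dotv mxE; apply: eq_bigr => i _; rewrite mxE. Qed.

Lemma dotvC u v : dotv u v = dotv v u.
Proof. by rewrite !dotvE; apply: eq_bigr => i _; rewrite mulrC. Qed.

Lemma dotvDr u v w : dotv u (v + w) = dotv u v + dotv u w.
Proof. by rewrite /dotv mulmxDr mxE. Qed.

Lemma dotvZr a u v : dotv u (a *: v) = a * dotv u v.
Proof. by rewrite /dotv -scalemxAr mxE. Qed.

Lemma dotvNr u v : dotv u (- v) = - dotv u v.
Proof. by rewrite -scaleN1r dotvZr mulN1r. Qed.

Lemma dotvBr u v w : dotv u (v - w) = dotv u v - dotv u w.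
Proof. by rewrite dotvDr dotvNr. Qed.

Lemma dotvDl u v w : dotv (v + w) u = dotv v u + dotv w u.
Proof. by rewrite dotvC dotvDr !(dotvC u). Qed.

Lemma dotvZl a u v : dotv (a *: u) v = a * dotv u v.
Proof. by rewrite dotvC dotvZr dotvC. Qed.

Lemma dotvNl u v : dotv (- u) v = - dotv u v.
Proof. by rewrite dotvC dotvNr dotvC. Qed.

Lemma dotvBl u v w : dotv (v - w) u = dotv v u - dotv w u.
Proof. by rewrite dotvDl dotvNl. Qed.

Lemma dotv_mulmx u F v : dotv u (F *m v) = dotv (F^T *m u) v.
Proof. by rewrite /dotv trmx_mul trmxK mulmxA. Qed.

Lemma dotv_delta u i : dotv u (delta_mx i 0) = u i 0.
Proof.
rewrite dotvE (bigD1 i)//= mxE !eqxx mulr1 big1 ?addr0// => j ji.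
by rewrite mxE (negbTE ji) mulr0.
Qed.

Lemma dotvv_eq0 u : dotv u u = 0 -> u = 0.
Proof.
move/eqP; rewrite dotvE psumr_eq0 => [/allP u0|i _]; last first.
  by rewrite -expr2 sqr_ge0.
apply/matrixP => i j; rewrite mxE (ord1 j); apply/eqP.
by have := u0 i (mem_index_enum _); rewrite mulf_eq0 orbb.
Qed.

Lemma normr_le_bound u a : 0 <= a -> (`|u| <= a) = [forall i, `|u i 0| <= a].
Proof.
move=> a0; have -> : `|u| = \big[Num.max/0]_ij `|u ij.1 ij.2| := mx_normrE u.
apply/bigmax_leP/forallP => [[_ ua] i|ua]; first exact: (ua (i, 0)).
by split=> // -[i j] _ /=; rewrite (ord1 j).
Qed.

Lemma ler_coord_norm u i : `|u i 0| <= `|u|.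
Proof. by move: (lexx `|u|); rewrite normr_le_bound// => /forallP. Qed.

Lemma dotv_le_norm u v : `|dotv u v| <= r%:R * `|u| * `|v|.
Proof.
rewrite dotvE (le_trans (ler_norm_sum _ _ _))//.
rewrite (_ : r%:R * _ * _ = \sum_(i < r) (`|u| * `|v|)); last first.
  by rewrite sumr_const card_ord -mulrA mulr_natl.
by apply: ler_sum => i _; rewrite normrM ler_pM// ler_coord_norm.
Qed.

Lemma trmx_fixed_orthogonal P u w : P^T = P -> P *m w = w ->
  dotv (u - P *m u) w = 0.
Proof.
move=> Psym Pw; rewrite dotvBl -{1}Pw dotv_mulmx Psym.
by rewrite subrr.
Qed.

Lemma exists_orthogonal_projector k (A : 'M[R]_(k, r)) :
  exists P : 'M[R]_r, [/\ P^T = P, P *m P = P &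
    forall u, A *m u = 0 <-> P *m u = u].
Proof.
have [q [N [Nfree NA]]] : exists q (N : 'M[R]_(q, r)),
    row_free N /\ forall x : 'rV[R]_r, x *m A^T = 0 <-> (x <= N)%MS.
  exists _, (row_base (kermx A^T)); split; first exact: row_base_free.
  by move=> x; rewrite eq_row_base; split=> /sub_kermxP.
pose G := N *m N^T.
have Gsym : G^T = G by rewrite /G trmx_mul trmxK.
have Gu : G \in unitmx.
  rewrite -row_free_unit -kermx_eq0; apply/eqP/row_matrixP => i.
  rewrite row0; set x := row i _.
  have xG : x *m G = 0 by rewrite /x -row_mul mulmx_ker row0.
  have : dotv (x *m N)^T (x *m N)^T = 0.
    by rewrite /dotv trmxK trmx_mul mulmxA -(mulmxA x) -/G xG mul0mx mxE.
  move/dotvv_eq0/(congr1 trmx); rewrite trmxK trmx0 => xN.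
  by apply: (row_free_inj Nfree); rewrite xN mul0mx.
exists (N^T *m invmx G *m N).
have PP : N^T *m invmx G *m N *m (N^T *m invmx G *m N) = N^T *m invmx G *m N.
  by rewrite !mulmxA -(mulmxA _ N) -/G mulmxKV.
split=> //.
  by rewrite !trmx_mul trmxK trmx_inv Gsym mulmxA.
move=> u; split => [Au|<-].
  have : (u^T <= N)%MS.
    by apply/NA; rewrite -trmx_mul Au trmx0.
  case/submxP => y /(congr1 trmx); rewrite trmxK => ->.
  by rewrite trmx_mul !mulmxA -(mulmxA _ N) -/G mulmxKV.
have AN : A *m N^T = 0.
  apply: trmx_inj; rewrite trmx_mul trmxK trmx0; apply/row_matrixP => i.
  by rewrite row_mul row0; apply/NA; exact: row_sub.
by rewrite !mulmxA AN !mul0mx.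
Qed.

Section subspace.
Variables (T : set 'cV[R]_r) (P F : 'M[R]_r).
Hypotheses (Psym : P^T = P) (PP : P *m P = P).
Hypothesis TP : forall u, T u <-> P *m u = u.

Lemma oproj_mulmx v : oproj T v = P *m v.
Proof.
rewrite /oproj; apply: xget_unique => [|u [/TP Tu uv]].
  split; first by apply/TP; rewrite mulmxA PP.
  by move=> w /TP; exact: trmx_fixed_orthogonal.
apply/eqP; rewrite -subr_eq0; apply/eqP/dotvv_eq0.
have TB : T (u - P *m v) by apply/TP; rewrite mulmxBr Tu mulmxA PP.
have := uv _ TB; have := trmx_fixed_orthogonal v Psym ((TP _).1 TB).
rewrite !dotvBl; lra.
Qed.

Lemma dotv_proj u v : T v -> dotv (P *m u) v = dotv u v.
Proof. by move=> /TP Tv; rewrite -{1}Psym -dotv_mulmx Tv. Qed.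

Hypotheses (Fsym : F^T = F) (PF : P *m F = F).
Hypothesis Fpos : posdef_on T F.

Let FP : F *m P = F.
Proof. by apply: trmx_inj; rewrite trmx_mul Psym Fsym PF. Qed.

Let quad_ge0 u : T u -> 0 <= dotv u (F *m u).
Proof.
move=> Tu; have [->|u0] := eqVneq u 0; last exact/ltW/Fpos.
by rewrite mulmx0 /dotv mulmx0 mxE.
Qed.

Lemma inv_onP v : T v -> T (inv_on T F v) /\ F *m inv_on T F v = v.
Proof.
move=> /TP Tv.
suff [w Tw Fw] : exists2 w, T w & F *m w = v.
  rewrite /inv_on; have := @xgetPex _ (0 : 'cV[R]_r) [set u | T u /\ F *m u = v].
  by apply; exists w.
pose H := F + (1%:M - P).
have Hu : H \in unitmx.
  rewrite -unitmx_tr -row_free_unit -kermx_eq0; apply/eqP/row_matrixP => i.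
  rewrite row0; set x := row i _.
  have xH : H *m x^T = 0.
    apply: trmx_inj; rewrite trmx_mul trmxK trmx0 /x -row_mul mulmx_ker row0//.
  have PH : P *m H = F by rewrite /H mulmxDr PF mulmxBr mulmx1 PP subrr addr0.
  have Fx : F *m x^T = 0 by rewrite -PH -mulmxA xH mulmx0.
  have Px : P *m x^T = 0.
    apply/eqP; apply/negP => /negP Px0.
    have TPx : T (P *m x^T) by apply/TP; rewrite mulmxA PP.
    have := Fpos TPx Px0.
    by rewrite [F *m _]mulmxA FP Fx /dotv mulmx0 mxE ltxx.
  move: xH; rewrite /H mulmxDl Fx mulmxBl Px mul1mx subr0 add0r.
  by move/(congr1 trmx); rewrite trmxK trmx0.
have Hv : F *m (invmx H *m v) + (1%:M - P) *m (invmx H *m v) = v.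
  by rewrite -mulmxDl -/H mulKVmx.
have Tw : P *m (invmx H *m v) = invmx H *m v.
  apply/eqP; rewrite -subr_eq0 -oppr_eq0 opprB -{1}(mul1mx (invmx H *m v)).
  rewrite -mulmxBl; move: (congr1 (mulmx (1%:M - P)) Hv).
  rewrite mulmxDr [X in X + _]mulmxA [X in _ + X]mulmxA.
  rewrite [X in X *m _ + _]mulmxBl PF mul1mx subrr mul0mx add0r.
  rewrite [X in X *m _]mulmxBl mul1mx mulmxBr mulmx1 PP subrr subr0 => ->.
  by rewrite mulmxBl mul1mx Tv subrr.
exists (invmx H *m v); first exact/TP.
by rewrite -[RHS]Hv mulmxBl mul1mx Tw subrr addr0.
Qed.

Lemma quad_form_sym u v : dotv u (F *m v) = dotv v (F *m u).
Proof. by rewrite dotv_mulmx Fsym dotvC. Qed.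

Lemma quad_form_cauchy u v : T u -> T v ->
  dotv u (F *m v) ^+ 2 <= dotv u (F *m u) * dotv v (F *m v).
Proof.
move=> Tu Tv; have [->|v0] := eqVneq v 0.
  by rewrite mulmx0 /dotv !mulmx0 !mxE mulr0 expr2 mulr0.
set a := dotv u (F *m u); set b := dotv u (F *m v); set c := dotv v (F *m v).
have c0 : 0 < c by exact: Fpos.
have Tw : T (c *: u - b *: v).
  by apply/TP; rewrite mulmxBr -!scalemxAr (TP u).1// (TP v).1.
have := quad_ge0 Tw.
rewrite mulmxBr -!scalemxAr !dotvBr !dotvBl !dotvZr !dotvZl.
rewrite (quad_form_sym v u) -/a -/b -/c.
have -> : c * (c * a) - c * (b * b) - (b * (c * b) - b * (b * c)) =
  c * (c * a - b ^+ 2) by ring.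
by rewrite pmulr_rge0// subr_ge0 mulrC.
Qed.

Lemma quad_form_coercive :
  exists2 c, 0 < c & forall u, T u -> c * `|u| ^+ 2 <= dotv u (F *m u).
Proof.
pose w i := inv_on T F (P *m delta_mx i 0).
have wP i : T (w i) /\ F *m w i = P *m delta_mx i 0.
  by apply: inv_onP; apply/TP; rewrite mulmxA PP.
pose C := 1 + \sum_i dotv (w i) (F *m w i).
have s0 : 0 <= \sum_i dotv (w i) (F *m w i).
  by apply: sumr_ge0 => i _; apply: quad_ge0; exact: (wP i).1.
have C0 : 0 < C by rewrite ltr_pwDl.
exists C^-1; first by rewrite invr_gt0.
move=> u Tu; rewrite ler_pdivrMl//.
have Qu := quad_ge0 Tu.
have CQ : 0 <= C * dotv u (F *m u) by rewrite mulr_ge0// ltW.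
rewrite -[leRHS]sqr_sqrtr// ler_sqr ?nnegrE ?sqrtr_ge0//.
rewrite normr_le_bound ?sqrtr_ge0//; apply/forallP => i.
rewrite -sqrtr_sqr ler_wsqrtr//.
have [Twi Fwi] := wP i.
have -> : u i 0 = dotv u (F *m w i).
  by rewrite Fwi dotvC dotv_proj// dotvC dotv_delta.
rewrite (le_trans (quad_form_cauchy Tu Twi))// mulrC ler_wpM2r//.
rewrite /C (bigD1 i)//= addrCA lerDl addr_ge0// sumr_ge0// => j _.
by apply: quad_ge0; exact: (wP j).1.
Qed.

End subspace.

End dotv.

(** * Derivatives and the tangent space *)

Section diff_lemmas.
Context {R : realType}.
Implicit Types U V W : normedModType R.

Lemma lipschitz_continuous V W (f : V -> W) (C : R) :
  (forall x y, `|f x - f y| <= C * `|x - y|) -> continuous f.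
Proof.
move=> fC x; apply/cvgrPdist_lt => e e0.
have C1 : 0 < `|C| + 1 by rewrite ltr_pwDr.
near=> y; apply: le_lt_trans (fC x y) _.
apply: (@le_lt_trans _ _ ((`|C| + 1) * `|x - y|)).
  by rewrite ler_wpM2r// (le_trans (ler_norm _))// lerDl.
rewrite mulrC -ltr_pdivlMr//; near: y; apply: cvgr_dist_lt => //.
by rewrite divr_gt0.
Unshelve. all: by end_near. Qed.

Lemma near_eq_differentiable V W (f g : V -> W) x :
  (\near x, f x = g x) -> differentiable f x -> differentiable g x.
Proof.
move=> fg df; have [dfc fE] := (diff_locallyP x f).1 df.
have gE : g \o shift x = cst (g x) + 'd f x +o_ (0 : V) id.
  apply/eqaddoP => e e0; move/eqaddoP : fE => /(_ e e0).
  have : \forall h \near (0 : V), f (h + x) = g (h + x).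
    by move: fg; rewrite (near_shift 0 x); apply: filterS => h; rewrite /= subr0.
  apply: filterS2 => h /= fgh; rewrite /shift/= /cst !fctE/= fgh.
  by rewrite (nbhs_singleton fg).
apply/diff_locallyP; have -> := diff_unique dfc gE; split => //.
Qed.

Lemma derive_diff_comp U V W (f : U -> V) (g : V -> W) x v :
  differentiable f x -> differentiable g (f x) ->
  'D_v (g \o f) x = 'D_('D_v f x) g (f x).
Proof.
move=> df dg; rewrite !deriveE//; last exact: differentiable_comp.
by rewrite diff_comp.
Qed.

Lemma differentiable_bound V W (f : V -> W) x e : differentiable f x ->
  0 < e -> exists2 rho : R, 0 < rho &
    forall h, `|h| < rho -> `|f (x + h) - f x - 'D_h f x| <= e * `|h|.
Proof.
move=> df e0; have [_ /eqaddoP/(_ e e0)] := (diff_locallyP x f).1 df.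
move=> /nbhs_ballP[rho /= rho0 H]; exists rho => // h hr.
have := H h; rewrite -ball_normE/= sub0r normrN => /(_ hr).
by rewrite !fctE/= [X in f X]addrC deriveE// opprD addrA.
Qed.

Lemma derive_linZ V W (f : V -> W) x a v : differentiable f x ->
  'D_(a *: v) f x = a *: 'D_v f x.
Proof. by move=> df; rewrite !deriveE// linearZ. Qed.

Lemma derive_lin_sum V W (f : V -> W) x I (s : seq I) (F : I -> V) :
  differentiable f x ->
  'D_(\sum_(i <- s) F i) f x = \sum_(i <- s) 'D_(F i) f x.
Proof.
move=> df; rewrite deriveE// linear_sum; apply: eq_bigr => i _.
by rewrite deriveE.
Qed.

Lemma open_near V (A : set V) (P : V -> Prop) x : open A -> A x ->
  (forall y, A y -> P y) -> \near x, P x.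
Proof.
by move=> oA Ax AP; apply: filterS AP _; exact: open_nbhs_nbhs.
Qed.

Lemma Cn_on_eq k V W (A : set V) (f g : V -> W) : open A ->
  (forall x, A x -> f x = g x) -> Cn_on k A f -> Cn_on k A g.
Proof.
move=> oA; elim: k f g => [|k IH] f g fg /=.
  move=> cf x Ax; suff: g @ x --> f x by rewrite fg.
  apply: cvg_trans (cf _ Ax); apply: near_eq_cvg.
  exact: open_near oA Ax _.
move=> [df Cf]; split.
  move=> x Ax; apply: near_eq_differentiable (df _ Ax).
  exact: open_near oA Ax _.
move=> v; apply: IH (Cf v) => x Ax; apply: near_eq_derive.
exact: open_near oA Ax _.
Qed.

Lemma Cn_onZ k V W (A : set V) (f : V -> W) a : open A ->
  Cn_on k A f -> Cn_on k A (fun x => a *: f x).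
Proof.
move=> oA; elim: k f => [|k IH] f /=.
  by move=> cf x Ax; apply: cvgZ; [exact: cvg_cst|exact: cf].
move=> [df Cf]; split => [x Ax|v]; first exact: differentiableZ (df _ Ax).
apply: Cn_on_eq (IH _ (Cf v)) => // x Ax.
by rewrite [RHS](@deriveZ _ _ _ f a)//; exact/diff_derivable/df.
Qed.

Lemma Cn_on_line k V W (B : set V) (f : V -> W) z w : open B ->
  Cn_on k B f ->
  Cn_on k [set t : R | B (z + t *: w)] (fun t => f (z + t *: w)).
Proof.
move=> oB; have lin t : is_diff t (fun t : R => z + t *: w) (fun t => t *: w).
  by apply: is_diff_eq; rewrite add0r.
have oI : open [set t : R | B (z + t *: w)].
  apply: (@open_comp _ _ (fun t : R => z + t *: w)) => // t _.
  exact/differentiable_continuous.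
have dl t v : 'D_v (fun t : R => z + t *: w) t = v *: w.
  by rewrite deriveE// diff_val.
elim: k f => [|k IH] f /=.
  move=> cf t It; apply: (continuous_comp (f := fun t : R => z + t *: w)).
    exact/differentiable_continuous.
  exact: cf.
move=> [df Cf]; split => [t It|v].
  apply: (differentiable_comp (f := fun t : R => z + t *: w)) => //.
  exact: df.
apply: Cn_on_eq (Cn_onZ v oI (IH _ (Cf w))) => // t It.
rewrite [RHS](derive_diff_comp (f := fun t : R => z + t *: w))//; last exact: df.
by rewrite dl derive_linZ//; exact: df.
Qed.

End diff_lemmas.

Section vec.
Context {R : realType} {m n : nat}.
Local Notation r := (n * m)%N.
Implicit Types (A : 'M[R]_(m, n)) (v : 'cV[R]_r).

Lemma vecK A : unvec (vec A) = A.
Proof. by rewrite /unvec /vec trmxK mxvecK trmxK. Qed.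

Lemma unvecK v : vec (unvec v : 'M[R]_(m, n)) = v.
Proof. by rewrite /unvec /vec trmxK vec_mxK trmxK. Qed.

Lemma unvec_is_linear : linear (@unvec R m n).
Proof. by move=> a u v; rewrite /unvec !(linearD, linearZ). Qed.

HB.instance Definition _ := GRing.isLinear.Build R 'cV[R]_r 'M[R]_(m, n) _
  (@unvec R m n) unvec_is_linear.

Lemma vec_is_linear : linear (@vec R m n).
Proof. by move=> a u v; rewrite /vec !(linearD, linearZ). Qed.

HB.instance Definition _ := GRing.isLinear.Build R 'M[R]_(m, n) 'cV[R]_r _
  (@vec R m n) vec_is_linear.

Lemma norm_unvec v : `|unvec v : 'M[R]_(m, n)| = `|v|.
Proof.
have nu : `|unvec v : 'M[R]_(m, n)| =
  \big[Num.max/0]_ij `|unvec v ij.1 ij.2| := mx_normrE _.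
apply/eqP; rewrite eq_le; apply/andP; split.
  rewrite nu; apply/bigmax_leP; split => // -[i j] _ /=.
  by rewrite /unvec !mxE ler_coord_norm.
rewrite normr_le_bound//; apply/forallP => k; rewrite nu.
case/mxvec_indexP: k => j i.
apply: le_trans (le_bigmax _ (fun ij => `|unvec v ij.1 ij.2|) (i, j)).
by rewrite /unvec !mxE.
Qed.

Lemma continuous_unvec : continuous (@unvec R m n).
Proof.
apply: (@lipschitz_continuous _ _ _ _ 1) => x y.
by rewrite -raddfB norm_unvec mul1r.
Qed.

Lemma unvec_sum v : unvec v = \sum_k v k 0 *: unvec (delta_mx k 0) :> 'M[R]_(m, n).
Proof.
rewrite {1}[v]matrix_sum_delta linear_sum; apply: eq_bigr => k _.
by rewrite big_ord1 linearZ.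
Qed.

End vec.

Section tangent.
Context {R : realType} {m n : nat}.
Local Notation mat := 'M[R]_(m, n).
Local Notation r := (n * m)%N.

Lemma tangent_kernel (M : set mat) Theta : embedded_submanifold M -> M Theta ->
  exists A : 'M[R]_r, forall v, tangentv M Theta v <-> A *m v = 0.
Proof.
move=> [k [_ chart]] MT.
have [A [B [phi [psi [[[oA AT] oB] [sphi spsi] AB BA MP]]]]] := chart _ MT.
have dphi : differentiable phi Theta by exact: (sphi 1%N).1.
have dpsi : differentiable psi (phi Theta) by exact: (spsi 1%N).1 _ (AB _ AT).1.
suff tP xi : tangent M Theta xi <->
    forall i : 'I_r, (k <= i)%N -> 'D_xi phi Theta i 0 = 0.
  pose J : 'M[R]_r := \matrix_(i, j)
    if (k <= i)%N then 'D_(unvec (delta_mx j 0)) phi Theta i 0 else 0.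
  have AE v i : (J *m v) i 0 =
      if (k <= i)%N then 'D_(unvec v) phi Theta i 0 else 0.
    rewrite mxE; case: ifPn => ki; last first.
      by rewrite big1// => j _; rewrite mxE (negbTE ki) mul0r.
    rewrite (unvec_sum v) derive_lin_sum// summxE; apply: eq_bigr => j _.
    by rewrite mxE ki derive_linZ// mxE mulrC.
  exists J => v; split=> [[xi /tP xiP <-]|Av].
    apply/colP => i; rewrite AE vecK [RHS]mxE.
    by case: ifPn => // /xiP.
  exists (unvec v); last by rewrite unvecK.
  by apply/tP => i ki; move/matrixP: Av => /(_ i 0); rewrite AE ki mxE.
split.
  move=> [I [c [[oI I0] sc cM c0 c1]]] i ki.
  have dc : differentiable c 0 by exact: (sc 1%N).1.
  have dphic : differentiable phi (c 0) by rewrite c0.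
  have xiE : xi = 'D_1 c 0 by rewrite -c1 derive1E.
  rewrite xiE -c0 -derive_diff_comp//.
  rewrite derive_mx; last exact/diff_derivable/differentiable_comp.
  rewrite mxE -[RHS](derive_cst (0 : R) (0 : R) 1); apply: near_eq_derive.
  have : \forall t \near (0 : R), A (c t).
    apply: (differentiable_continuous dc); rewrite c0.
    exact: open_nbhs_nbhs.
  have : \forall t \near (0 : R), I t by exact: open_nbhs_nbhs.
  by apply: filterS2 => t It At /=; apply: (MP _ At).1 => //; exact: cM.
move=> xiP; pose w := 'D_xi phi Theta.
have [BT psiT] := AB _ AT.
exists [set t : R | B (phi Theta + t *: w)].
exists (fun t => psi (phi Theta + t *: w)).
have lin t : is_diff t (fun t : R => phi Theta + t *: w) (fun t => t *: w).
  by apply: is_diff_eq; rewrite add0r.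
split.
- split; last by rewrite /= scale0r addr0.
  apply: (@open_comp _ _ (fun t : R => phi Theta + t *: w)) => // t _.
  exact/differentiable_continuous.
- by move=> j; apply: Cn_on_line.
- move=> t Bt; have [At phit] := BA _ Bt; apply/(MP _ At) => i ki.
  by rewrite phit 2!mxE xiP// mulr0 addr0; apply: (MP _ AT).1.
- by rewrite scale0r addr0.
- rewrite derive1E (derive_diff_comp (f := fun t : R => phi Theta + t *: w))//.
    have -> : 'D_1 (fun t : R => phi Theta + t *: w) 0 = w.
      by rewrite deriveE// diff_val scale1r.
    rewrite scale0r addr0 -derive_diff_comp//.
    rewrite -[RHS](derive_id Theta xi); apply: near_eq_derive.
    by apply: open_near oA AT _ => x /AB [].
  by rewrite scale0r addr0.
Qed.

End tangent.

(** * Rescaled minimizers of a perturbed quadratic program *)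

Section rescaled_minimizers.
Context {R : realType} {r : nat}.
Local Notation V := 'cV[R]_r.

Lemma compact_closed_ball (a : R) : compact [set d : V | `|d| <= a].
Proof.
have trn (x : 'rV[R]_r) : `|x^T| = `|x|.
  have nx : `|x| = \big[Num.max/0]_ij `|x ij.1 ij.2| := mx_normrE x.
  apply/eqP; rewrite eq_le; apply/andP; split.
    rewrite normr_le_bound//; apply/forallP => k; rewrite nx mxE.
    exact: (le_bigmax _ (fun ij => `|x ij.1 ij.2|) (0, k)).
  rewrite nx; apply/bigmax_leP; split => // -[i j] _ /=.
  by rewrite (ord1 i); have := ler_coord_norm x^T j; rewrite mxE.
have ctr : continuous (fun x : 'rV[R]_r => x^T).
  apply: (@lipschitz_continuous _ _ _ _ 1) => x y.
  by rewrite -raddfB trn mul1r.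
have -> : [set d : V | `|d| <= a] =
    (fun x : 'rV[R]_r => x^T) @` [set x | `|x| <= a].
  apply/seteqP; split => [d /= da|d [x /= xa <-]]; last by rewrite /= trn.
  by exists d^T; rewrite ?trmxK//= -trn trmxK.
apply: continuous_compact; first exact: continuous_subspaceT.
apply: bounded_closed_compact.
  by exists a; split; rewrite ?num_real// => b ab x /= /le_trans; apply; exact: ltW.
rewrite (_ : mkset _ = Num.norm @^-1` [set x : R | x <= a])//.
by apply: closed_comp => [x _|]; [exact: norm_continuous|exact: closed_le].
Qed.

Lemma mulmx_bound (A : 'M[R]_r) :
  exists2 C, 0 < C & forall u : V, `|A *m u| <= C * `|u|.
Proof.
pose C := 1 + \sum_i \sum_j `|A i j|.
have C0 : 0 < C.
  by rewrite ltr_pwDl// sumr_ge0// => i' _; rewrite sumr_ge0.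
exists C => // u; rewrite normr_le_bound; last by rewrite mulr_ge0// ltW.
apply/forallP => i; rewrite mxE (le_trans (ler_norm_sum _ _ _))//.
apply: (@le_trans _ _ (\sum_j `|A i j| * `|u|)).
  by apply: ler_sum => j _; rewrite normrM ler_wpM2l// ler_coord_norm.
rewrite -mulr_suml ler_wpM2r// /C [X in 1 + X](bigD1 i)//= addrCA lerDl addr_ge0//.
by rewrite sumr_ge0// => j _; rewrite sumr_ge0.
Qed.

Lemma continuous_mulmx (A : 'M[R]_r) : continuous (fun u : V => A *m u).
Proof.
have [C _ AC] := mulmx_bound A; apply: (@lipschitz_continuous _ _ _ _ C) => x y.
by rewrite -mulmxBr.
Qed.

Variables (T : set V) (P F : 'M[R]_r) (g : V) (phi k : V -> R) (rho0 : R).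
Hypotheses (Psym : P^T = P) (PP : P *m P = P).
Hypothesis TP : forall u, T u <-> P *m u = u.
Hypotheses (Fsym : F^T = F) (PF : P *m F = F).
Hypothesis Fpos : posdef_on T F.
Hypotheses (Tg : T g) (g0 : g != 0).
Hypothesis rho0_gt0 : 0 < rho0.
Hypothesis cont_k : forall d : V, `|d| < rho0 -> {for d, continuous k}.
Hypothesis cont_phi : forall d : V, `|d| < rho0 -> {for d, continuous phi}.
Hypothesis k2 : forall e : R, 0 < e -> exists2 rho : R, 0 < rho &
  forall d : V, T d -> `|d| < rho ->
  `|k d - dotv d (F *m d) / 2| <= e * `|d| ^+ 2.
Hypothesis phi1 : forall e : R, 0 < e -> exists2 rho : R, 0 < rho &
  forall d : V, T d -> `|d| < rho -> `|phi d - phi 0 - dotv g d| <= e * `|d|.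

Let TZ a u : T u -> T (a *: u).
Proof. by move=> /TP Tu; apply/TP; rewrite -scalemxAr Tu. Qed.

Let T0 : T 0. Proof. by apply/TP; rewrite mulmx0. Qed.

Let closed_T : closed T.
Proof.
have -> : T = \bigcap_(i in [set: 'I_r])
    (fun d : V => (P *m d - d) i 0) @^-1` [set 0].
  apply/seteqP; split => [d /TP Pd i _ /=|d Pd].
    by rewrite Pd subrr mxE.
  apply/TP/eqP; rewrite -subr_eq0; apply/eqP/colP => i.
  by rewrite Pd// [RHS]mxE.
apply: closed_bigI => i _; apply: closed_comp; last exact: closed_eq.
move=> d _; apply: (@continuous_comp _ _ _ (fun d : V => P *m d - d)
  (fun M : V => M i 0)); last exact: coord_continuous.
have -> : (fun d : V => P *m d - d) = mulmx (P - 1%:M).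
  by apply/funext => u; rewrite mulmxBl mul1mx.
exact: continuous_mulmx.
Qed.

Let v := inv_on T F g.
Let Tv : T v. Proof. exact: (inv_onP Psym PP TP Fsym PF Fpos Tg).1. Qed.
Let Fv : F *m v = g. Proof. exact: (inv_onP Psym PP TP Fsym PF Fpos Tg).2. Qed.

Let gv_gt0 : 0 < dotv g v.
Proof.
rewrite dotvC -Fv; apply: Fpos => //; apply/negP => /eqP v0.
by move: g0; rewrite -Fv v0 mulmx0 eqxx.
Qed.

Let G := Num.sqrt (dotv g v).
Let G0 : 0 < G. Proof. by rewrite sqrtr_gt0. Qed.
Let GG : G ^+ 2 = dotv g v. Proof. by rewrite sqr_sqrtr// ltW. Qed.

Let l : V := G^-1 *: (- v).
Let Tl : T l. Proof. by apply: TZ; rewrite -scaleN1r; exact: TZ. Qed.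

Let lFw w : dotv l (F *m w) = - (G^-1 * dotv g w).
Proof.
by rewrite (quad_form_sym Fsym) /l -scalemxAr mulmxN Fv dotvZr dotvNr mulrN dotvC.
Qed.

Let gl : dotv g l = - G.
Proof.
rewrite /l dotvZr dotvNr -GG mulrN expr2 mulKf//; exact: lt0r_neq0.
Qed.

Let Ql : dotv l (F *m l) = 1.
Proof. by rewrite lFw gl mulrN opprK mulVf// gt_eqF. Qed.

Let feas (rho eps : R) := [set d : V | [/\ `|d| < rho, T d & k d <= eps ^+ 2 / 2]].

Lemma argmin_nonempty (rho rho' eps : R) : 0 < rho' -> rho' < rho -> rho' < rho0 ->
  k 0 = 0 ->
  (forall d, feas rho eps d -> `|d| <= rho') ->
  argmin (feas rho eps) phi !=set0.
Proof.
move=> r0 rr rr0 k0 fr.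
pose S := [set d : V | [/\ `|d| <= rho', T d & k d <= eps ^+ 2 / 2]].
have S0 : S !=set0.
  by exists 0; rewrite /S/= normr0 k0 ltW//; split => //; rewrite mulr_ge0 ?sqr_ge0.
have cS : compact S.
  apply: (@subclosed_compact _ _ _ _ (@compact_closed_ball rho')); last by move=> d [].
  have cB : closed [set d : V | `|d| <= rho'].
    exact: compact_closed (@norm_hausdorff _ _) (@compact_closed_ball rho').
  move=> d cd.
  have db : `|d| <= rho'.
    by apply: cB; apply: closureS cd => x [].
  split => //.
    by apply: closed_T; apply: closureS cd => x [].
  rewrite leNgt; apply/negP => kd.
  have ck : {for d, continuous k} by apply: cont_k; exact: le_lt_trans rr0.
  have : nbhs d [set x | eps ^+ 2 / 2 < k x].
    apply: (ck [set x : R | eps ^+ 2 / 2 < x]).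
    by apply: open_nbhs_nbhs; split => //; exact: open_gt.
  by move=> /cd[x [[_ _]]] /le_lt_trans H /H; rewrite ltxx.
have cphi : {within S, continuous phi}.
  apply: continuous_in_subspaceT => x; rewrite inE => -[xr _ _].
  by apply: cont_phi; exact: le_lt_trans rr0.
have [d] := compact_EVT_min S0 cS cphi.
rewrite inE => -[dr Td kd] dmin; exists d; split.
  by split => //; exact: le_lt_trans rr.
move=> d' fd'; apply: dmin; rewrite inE; have [_ Td' kd'] := fd'.
by split => //; exact: fr.
Qed.

Lemma rescaled_argmin_quadratic : \forall rho \near 0^'+,
  rescaled_argmin_cvg (feas rho) phi l.
Proof.
have [c c0 cQ] := quad_form_coercive Psym PP TP Fsym PF Fpos.
have k0 : k 0 = 0.
  have [rho rho_gt0 /(_ 0 T0)] := k2 ltr01; rewrite normr0 => /(_ rho_gt0).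
  by rewrite mulmx0 /dotv mulmx0 mxE mul0r subr0 expr0n mulr0 normr_le0 => /eqP.
have [rho1 rho1_gt0 k_low] : exists2 rho1, 0 < rho1 & forall d, T d ->
    `|d| < rho1 -> c / 4 * `|d| ^+ 2 <= k d.
  have c4 : 0 < c / 4 by rewrite divr_gt0.
  have [rho1 rho1_gt0 H] := k2 c4; exists rho1 => // d Td dr.
  have := H d Td dr; have := cQ d Td; rewrite ler_norml => q /andP[kd _].
  lra.
pose Ce := Num.sqrt (2 / c).
have Ce0 : 0 <= Ce by exact: sqrtr_ge0.
have Ce2 : Ce ^+ 2 = 2 / c by rewrite sqr_sqrtr// divr_ge0// ltW.
near=> rho.
have rho_gt0 : 0 < rho by near: rho; exact: nbhs_right_gt.
have rho_lt0 : rho < rho0 by near: rho; exact: nbhs_right_lt.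
have rho_lt1 : rho < rho1 by near: rho; exact: nbhs_right_lt.
have feas_bound eps d : 0 < eps -> feas rho eps d -> `|d| <= Ce * eps.
  move=> eps0 [dr Td kd].
  have kl := k_low d Td (lt_trans dr rho_lt1).
  rewrite -ler_sqr ?nnegrE//; last by rewrite mulr_ge0// ltW.
  rewrite exprMn Ce2 mulrAC ler_pdivlMr// mulrC; lra.
move=> W /nbhs_ballP[e0 /= e0_gt0 eW].
(* [dl * K < D] makes the final bound [(w - l)^T F (w - l) <= dl * K] smaller
   than [c * e0 ^+ 2]; [N] bounds both [`|w|] and [`|l|]. *)
pose D := c * e0 ^+ 2.
have D0 : 0 < D by rewrite mulr_gt0// exprn_gt0.
pose K := 3 + 2 / G.
have K0 : 0 < K by rewrite addr_gt0// divr_gt0.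
pose dl := Num.min (1 / 2) (D / (2 * K)).
have dl0 : 0 < dl by rewrite lt_min !divr_gt0 ?mulr_gt0.
have dl1 : dl <= 1 / 2 by rewrite ge_min lexx.
have dlK : dl * K < D.
  have : dl <= D / (2 * K) by rewrite ge_min lexx orbT.
  rewrite ler_pdivlMr ?mulr_gt0//; lra.
pose N := Ce + `|l| + 1.
have l0 : 0 <= `|l| by [].
have N0 : 0 < N by rewrite /N; lra.
have [r1 r1_gt0 k_two] := k2 (divr_gt0 dl0 (mulr_gt0 (ltr0n R 2) (exprn_gt0 2 N0))).
have [r2 r2_gt0 phi_one] := phi1 (divr_gt0 dl0 N0).
near=> eps.
have eps0 : 0 < eps by near: eps; exact: nbhs_right_gt.
have Nrho : N * eps < rho.
  rewrite mulrC -ltr_pdivlMr//; near: eps; apply: nbhs_right_lt.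
  by rewrite divr_gt0.
have Nr1 : N * eps < r1.
  rewrite mulrC -ltr_pdivlMr//; near: eps; apply: nbhs_right_lt.
  by rewrite divr_gt0.
have Nr2 : N * eps < r2.
  rewrite mulrC -ltr_pdivlMr//; near: eps; apply: nbhs_right_lt.
  by rewrite divr_gt0.
have CeN : Ce * eps <= N * eps by rewrite ler_pM2r// /N; lra.
have lN : `|l| * eps <= N * eps by rewrite ler_pM2r// /N; lra.
split.
  apply: (@argmin_nonempty rho (N * eps)) => //.
  - by rewrite mulr_gt0.
  - exact: lt_trans Nrho rho_lt0.
  - by move=> d fd; exact: le_trans (feas_bound _ _ eps0 fd) CeN.
move=> d [fd dmin].
have dCe := feas_bound _ _ eps0 fd.
have dN : `|d| <= N * eps by exact: le_trans dCe CeN.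
have [dr Td kd] := fd.
pose w := eps^-1 *: d.
have dE : d = eps *: w by rewrite /w scalerA divff ?scale1r// gt_eqF.
have Tw : T w by exact: TZ.
have wCe : `|w| <= Ce.
  by rewrite -(ler_pM2l eps0) -{1}(gtr0_norm eps0) -normrZ -dE mulrC.
have w_ge0 : 0 <= `|w| by [].
have wN : `|w| <= N by rewrite /N; lra.
have N2 : 0 < N ^+ 2 by rewrite exprn_gt0.
have bnd2 x : 0 <= x -> x <= N -> dl / (2 * N ^+ 2) * x ^+ 2 <= dl / 2.
  move=> x0 xN.
  have -> : dl / (2 * N ^+ 2) * x ^+ 2 = dl / 2 * (x ^+ 2 / N ^+ 2).
    by field; rewrite lt0r_neq0.
  rewrite ler_piMr ?divr_ge0// ?(ltW dl0)// ler_pdivrMr// mul1r.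
  by rewrite ler_sqr ?nnegrE// ltW.
have bnd1 x : 0 <= x -> x <= N -> dl / N * x <= dl.
  by move=> x0 xN; rewrite mulrAC ler_pdivrMr// ler_pM2l.
have eps2 : 0 < eps ^+ 2 by rewrite exprn_gt0.
have scale (a : R) u : 0 <= a ->
    (dotv (a *: u) (F *m (a *: u)) = a ^+ 2 * dotv u (F *m u)) *
    (`|a *: u| ^+ 2 = a ^+ 2 * `|u| ^+ 2).
  move=> a0; split; first by rewrite -scalemxAr dotvZr dotvZl; ring.
  by rewrite normrZ ger0_norm// exprMn.
have Qw : dotv w (F *m w) <= 1 + dl.
  have := k_two d Td (le_lt_trans dN Nr1).
  have := scale eps w (ltW eps0); rewrite -dE => -[-> ->].
  rewrite ler_norml => /andP[+ _].
  have := bnd2 _ w_ge0 wN; rewrite -(ler_pM2l eps2) -[_ <= 1 + dl](ler_pM2l eps2).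
  set C := dl / (2 * N ^+ 2); set B := dotv _ _.
  lra.
pose d' := ((1 - dl) * eps) *: l.
have a_ge0 : 0 <= (1 - dl) * eps by rewrite mulr_ge0 ?(ltW eps0)//; lra.
have a_le : (1 - dl) * eps <= eps.
  by rewrite ler_piMl ?(ltW eps0)//; lra.
have Td' : T d' by exact: TZ.
have d'l : `|d'| <= `|l| * eps.
  by rewrite normrZ ger0_norm// mulrC ler_wpM2l.
have d'N : `|d'| <= N * eps by exact: le_trans d'l lN.
have lN' : `|l| <= N by rewrite /N; lra.
have fd' : feas rho eps d'.
  split => //; first exact: le_lt_trans d'N Nrho.
  have := k_two d' Td' (le_lt_trans d'N Nr1).
  have := scale _ l a_ge0; rewrite -/d' Ql => -[-> ->].
  rewrite ler_norml => /andP[_ +].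
  have := bnd2 _ l0 lN'; set a := (1 - dl) * eps.
  have a2 : 0 <= a ^+ 2 by exact: sqr_ge0.
  move=> /(ler_wpM2l a2).
  have : a ^+ 2 * (1 + dl) <= eps ^+ 2.
    have -> : a ^+ 2 * (1 + dl) = eps ^+ 2 * ((1 - dl) * (1 - dl ^+ 2)).
      by rewrite /a; ring.
    rewrite ler_piMr ?(ltW eps2)//; have : 0 <= dl ^+ 2 by exact: sqr_ge0.
    have : dl ^+ 2 <= 1 by rewrite expr_le1//; lra.
    by move=> ? ?; rewrite mulr_ile1//; lra.
  set C := dl / (2 * N ^+ 2).
  lra.
have gw : dotv g w <= dl - (1 - dl) * G.
  have pd := phi_one d Td (le_lt_trans dN Nr2).
  have pd' := phi_one d' Td' (le_lt_trans d'N Nr2).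
  move: pd pd'; rewrite !ler_norml => /andP[pd _] /andP[_ pd'].
  have pp := dmin _ fd'.
  have gd : dotv g d = eps * dotv g w by rewrite {1}dE dotvZr.
  have gd' : dotv g d' = - (eps * ((1 - dl) * G)).
    by rewrite dotvZr gl; ring.
  rewrite gd in pd; rewrite gd' in pd'.
  have nd : dl / N * (`|d| + `|d'|) <= dl * eps.
    rewrite mulrAC ler_pdivrMr// -mulrA ler_pM2l// mulrC.
    rewrite /N; lra.
  rewrite -(ler_pM2l eps0); lra.
apply: eW; rewrite -ball_normE/= distrC -/w.
have Twl : T (w - l) by apply/TP; rewrite mulmxBr !(TP _).1.
have := cQ _ Twl; rewrite mulmxBr !dotvBr !dotvBl Ql (quad_form_sym Fsym w l) lFw.
move=> cwl; have : c * `|w - l| ^+ 2 < c * e0 ^+ 2.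
  apply: le_lt_trans cwl _; rewrite -/D.
  have : G^-1 * dotv g w <= G^-1 * dl - (1 - dl).
    by rewrite ler_pdivrMl// mulrBr mulrA divff ?lt0r_neq0// mul1r mulrC.
  have : dl * K = 3 * dl + 2 * (G^-1 * dl) by rewrite /K; ring.
  lra.
by rewrite ltr_pM2l// ltr_sqr ?nnegrE// ltW.
Unshelve. all: by end_near. Qed.

End rescaled_minimizers.

(** * Taylor expansion and retractions *)

Section taylor.
Context {R : realType} {m n : nat}.
Local Notation mat := 'M[R]_(m, n).
Local Notation r := (n * m)%N.
Local Notation e_ k := (unvec (delta_mx k 0) : mat).

Lemma taylor2 (K : mat -> R) (A : set mat) (Theta : mat) :
  open_nbhs Theta A -> (forall x, A x -> differentiable K x) ->
  (forall v, differentiable (fun x => 'D_v K x) Theta) ->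
  K Theta = 0 -> (forall v, 'D_v K Theta = 0) ->
  forall e : R, 0 < e -> exists2 rho : R, 0 < rho & forall u : 'cV[R]_r,
    `|u| < rho ->
    `|K (Theta + unvec u) - 'D_(unvec u) (fun x => 'D_(unvec u) K x) Theta / 2|
      <= e * `|u| ^+ 2.
Proof.
move=> [oA AT] dK ddK K0 DK0 e e0.
pose e' := e / (r%:R + 1).
have r1 : 0 < r%:R + 1 :> R by rewrite ltr_wpDl.
have e'0 : 0 < e' by rewrite divr_gt0.
have [rho1 rho1_gt0 A1] : exists2 rho : R, 0 < rho &
    forall h : mat, `|h| < rho -> A (Theta + h).
  have /nbhs_ballP[rho /= rho0 H] := open_nbhs_nbhs (conj oA AT).
  exists rho => // h hr; apply: H; rewrite -ball_normE/= opprD addrA subrr sub0r.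
  by rewrite normrN.
have [rho2 rho2_gt0 D2] : exists2 rho : R, 0 < rho & forall k (h : mat),
    `|h| < rho -> `|'D_(e_ k) K (Theta + h) -
      'D_h (fun x => 'D_(e_ k) K x) Theta| <= e' * `|h|.
  have H k := differentiable_bound (ddK (e_ k)) e'0.
  pose f k := sval (cid2 (H k)).
  exists (\big[Num.min/1]_k f k).
    apply/bigmin_gtP; split => // k _.
    by rewrite /f; case: cid2.
  move=> k h /bigmin_gtP[_ /(_ k isT)]; rewrite /f; case: cid2 => /= rho _ Hk hr.
  by have := Hk _ hr; rewrite DK0 subr0.
exists (Num.min rho1 rho2); first by rewrite lt_min rho1_gt0.
move=> u; rewrite lt_min => /andP[u1 u2].
set w : mat := unvec u; pose b : R := 'D_w (fun x => 'D_w K x) Theta.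
have nw : `|w| = `|u| by exact: norm_unvec.
have At (t : R) : 0 <= t <= 1 -> A (Theta + t *: w).
  move=> /andP[t0 t1]; apply: A1; rewrite normrZ nw ger0_norm//.
  by apply: le_lt_trans u1; rewrite ler_piMl.
pose g (t : R) := K (Theta + t *: w) - t ^+ 2 / 2 * b.
pose g' (t : R) : R := 'D_w K (Theta + t *: w) - t * b.
have lin (t : R) : is_diff t (fun t : R => Theta + t *: w) (fun t => t *: w).
  by apply: is_diff_eq; rewrite add0r.
have dg (t : R) : 0 <= t <= 1 -> is_derive t (1 : R) g (g' t).
  move=> t01; have dKt := dK _ (At t t01).
  apply: is_deriveB.
    apply: DeriveDef.
      apply: diff_derivable.
      exact: (differentiable_comp (f := fun t : R => Theta + t *: w)).
    rewrite (derive_diff_comp (f := fun t : R => Theta + t *: w))//.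
    congr ('D_ _ K _); by rewrite deriveE// diff_val scale1r.
  have -> : (fun t : R => t ^+ 2 / 2 * b) = (b / 2) \*: (fun t : R => t ^+ 2).
    by apply/funext => s /=; rewrite [RHS]mulrC mulrAC mulrA.
  apply: is_derive_eq.
  by rewrite /GRing.scale/=; field.
have DwE x : A x -> 'D_w K x = \sum_k u k 0 *: 'D_(e_ k) K x.
  move=> Ax; rewrite /w (unvec_sum u) derive_lin_sum; last exact: dK.
  by apply: eq_bigr => k _; rewrite derive_linZ//; exact: dK.
have bE : b = \sum_k u k 0 * 'D_w (fun x => 'D_(e_ k) K x) Theta.
  rewrite /b.
  have -> : 'D_w (fun x => 'D_w K x) Theta =
      'D_w (\sum_k (fun x => u k 0 *: 'D_(e_ k) K x)) Theta.
    apply: near_eq_derive; apply: open_near oA AT _ => x Ax.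
    by rewrite fct_sumE DwE.
  rewrite derive_sum => [|k]; last exact/diff_derivable/differentiableZ.
  by apply: eq_bigr => k _; rewrite deriveZ//; exact/diff_derivable.
have g'_bound (t : R) : 0 <= t <= 1 -> `|g' t| <= e * `|u| ^+ 2.
  move=> t01; have /andP[t0 t1] := t01.
  have -> : g' t = \sum_k u k 0 * ('D_(e_ k) K (Theta + t *: w) -
      'D_(t *: w) (fun x => 'D_(e_ k) K x) Theta).
    rewrite /g' bE mulr_sumr DwE; last exact: At.
    rewrite -sumrB; apply: eq_bigr => k _.
    rewrite derive_linZ; last exact: ddK.
    by rewrite /GRing.scale/=; ring.
  apply: le_trans (ler_norm_sum _ _ _) _.
  apply: (@le_trans _ _ (\sum_(k < r) (e' * `|u| ^+ 2))).
    apply: ler_sum => k _; rewrite normrM mulrC expr2 mulrA.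
    have tw : `|t *: w| <= `|u|.
      by rewrite normrZ nw ger0_norm// ler_piMl.
    apply: ler_pM => //; last exact: ler_coord_norm.
    apply: le_trans (D2 _ _ (le_lt_trans tw u2)) _.
    by rewrite ler_wpM2l// ltW.
  rewrite sumr_const card_ord -mulr_natl mulrA ler_wpM2r//.
  by rewrite /e' mulrA ler_pdivrMr// mulrC ler_pM2l// lerDl.
have cg : {within `[0%R, 1%R], continuous g}.
  apply: derivable_within_continuous => t; rewrite in_itv/= => t01.
  exact: (@ex_derive _ _ _ _ _ _ _ (dg t t01)).
have dg' (t : R) : t \in `]0, 1[%R -> is_derive t (1 : R) g (g' t).
  by rewrite in_itv/= => /andP[t0 t1]; apply: dg; rewrite !ltW.
have [t] := MVT_segment ler01 dg' cg.
rewrite in_itv/= => t01; rewrite /g scale1r scale0r addr0 K0 subr0 mulr1.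
rewrite expr1n expr0n/= !mul0r subrr subr0 mul1r mulrC => ->.
exact: g'_bound.
Qed.

Lemma retraction_extension (M : set mat) Rt Theta :
  retraction M Rt -> M Theta ->
  (forall a xi, tangent M Theta xi -> tangent M Theta (a *: xi)) ->
  tangent M Theta 0 ->
  exists (h : mat -> mat) (rho : R), [/\ 0 < rho,
    forall xi, `|xi| < rho -> differentiable h xi,
    forall xi, `|xi| < rho -> tangent M Theta xi -> h xi = Rt Theta xi,
    h 0 = Theta & forall xi, tangent M Theta xi -> 'D_xi h 0 = xi].
Proof.
move=> [sR MR R0 R1] MT TZ T0.
have [A [H [[oA AT0] sH HR]]] := sR (Theta, 0) (conj MT T0).
have dpair xi : differentiable (fun x : mat => (Theta, x)) xi.
  exact: differentiable_pair.
have [rho rho0 Arho] : exists2 rho : R, 0 < rho &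
    forall xi, `|xi| < rho -> A (Theta, xi).
  have : nbhs (0 : mat) [set xi | A (Theta, xi)].
    by apply: (differentiable_continuous (dpair 0)); exact: open_nbhs_nbhs.
  move=> /nbhs_ballP[rho /= rho0 Hr]; exists rho => // xi xr; apply: Hr.
  by rewrite -ball_normE/= sub0r normrN.
have hR xi : `|xi| < rho -> tangent M Theta xi -> H (Theta, xi) = Rt Theta xi.
  by move=> xr Txi; apply: (HR (Theta, xi)); [|exact: Arho].
have dh xi : `|xi| < rho -> differentiable (fun x => H (Theta, x)) xi.
  move=> xr; apply: (differentiable_comp (f := fun x : mat => (Theta, x))) => //.
  exact: (sH 1%N).1 _ (Arho _ xr).
exists (fun xi => H (Theta, xi)), rho; split => //.
  by rewrite hR ?normr0// R0.
move=> xi Txi.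
have dline (t : R) : is_diff t (fun t : R => t *: xi) (fun t => t *: xi).
  by apply: is_diff_eq.
have D1 : 'D_1 (fun t : R => t *: xi) 0 = xi.
  by rewrite deriveE// diff_val scale1r.
have -> : 'D_xi (fun x => H (Theta, x)) 0 =
    'D_1 (fun t : R => H (Theta, t *: xi)) 0.
  rewrite (derive_diff_comp (f := fun t : R => t *: xi)
    (g := fun x => H (Theta, x)))//; last by apply: dh; rewrite scale0r normr0.
  by rewrite D1 scale0r.
rewrite -[RHS](R1 _ _ MT Txi) derive1E; apply: near_eq_derive.
have : \forall t \near (0 : R), `|t *: xi| < rho.
  have cl : {for 0, continuous (fun t : R => t *: xi)}.
    exact/differentiable_continuous.
  apply: (cl [set x | `|x| < rho]); rewrite scale0r.
  apply/nbhs_ballP; exists rho => //= x; rewrite -ball_normE/= sub0r.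
  by rewrite normrN.
by apply: filterS => t tr; apply: hR => //; exact: TZ.
Qed.

End taylor.

(** * Differentiation of the expected divergence *)

Section derive_product.
Context {R : realType} {V : normedModType R}.
Implicit Types (f g : V -> R) (x v : V).

Lemma derivable_subc f c x v : derivable f x v ->
  derivable (fun x => f x - c) x v.
Proof. by move=> df; exact: (derivableB df (derivable_cst c x v)). Qed.

Lemma derive_subc f c x v : derivable f x v ->
  'D_v (fun x => f x - c) x = 'D_v f x.
Proof.
move=> df; rewrite -[RHS]subr0 -(derive_cst c x v).
exact: (deriveB df (derivable_cst c x v)).
Qed.

Lemma derive_mul_subc f g c x v : derivable f x v -> derivable g x v ->
  'D_v (fun x => f x * (g x - c)) x = 'D_v f x * (g x - c) + f x * 'D_v g x.
Proof.
move=> df dg; rewrite -(derive_subc c dg) [RHS]addrC [X in _ = _ + X]mulrC.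
exact: (deriveM df (derivable_subc (c := c) dg)).
Qed.

Lemma derive_mul_subcD f g h c x v : derivable f x v -> derivable g x v ->
  derivable h x v ->
  'D_v (fun x => f x * (g x - c) + h x) x =
  'D_v f x * (g x - c) + f x * 'D_v g x + 'D_v h x.
Proof.
move=> df dg dh; rewrite -derive_mul_subc//.
exact: (deriveD (derivableM df (derivable_subc (c := c) dg)) dh).
Qed.

End derive_product.

Section logarithmic_derivative.
Context {R : realType} {V : normedModType R}.
Variables (A : set V) (x0 : V) (p : V -> R).
Hypothesis A0 : open_nbhs x0 A.
Hypothesis p_ge0 : forall x, 0 <= p x.
Hypothesis supp : forall x, A x -> (0 < p x <-> 0 < p x0).
Hypothesis dp : forall x, A x -> differentiable p x.

Let ln_p_facts x v : A x ->
  [/\ differentiable (fun x => ln (p x)) x,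
      'D_v (fun x => ln (p x)) x = 'D_v p x / p x &
      p x * 'D_v (fun x => ln (p x)) x = 'D_v p x].
Proof.
move=> Ax; have [oA _] := A0.
have [p0|p0] := ltP 0 (p x0).
  have px : 0 < p x by apply/supp.
  have dln : differentiable (@ln R) (p x).
    by apply/derivable1_diffP; apply: ex_derive; exact: is_derive1_ln.
  have E : 'D_v (fun x => ln (p x)) x = 'D_v p x / p x.
    rewrite (derive_diff_comp (f := p) (g := @ln R))//; last exact: dp.
    rewrite -[X in 'D_X _ _]mulr1 (derive_linZ (f := @ln R) _ (1 : R))//.
    by rewrite (@derive_val _ _ _ _ _ _ _ (is_derive1_ln px)).
  split => //; first by apply: (differentiable_comp (f := p)) => //; exact: dp.
  by rewrite E mulrCA divff ?mulr1// gt_eqF.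
have pA y : A y -> p y = 0.
  move=> Ay; apply/eqP; rewrite eq_le p_ge0 andbT leNgt; apply/negP.
  by move/(supp Ay); rewrite ltNge p0.
have D0 : 'D_v p x = 0.
  rewrite -[RHS](derive_cst (0 : R) x v); apply: near_eq_derive.
  by apply: open_near oA Ax _ => y /pA.
have ln_near : \near x, (cst 0 : V -> R) x = ln (p x).
  by apply: open_near oA Ax _ => y /pA ->; rewrite ln0.
have L0 : 'D_v (fun x => ln (p x)) x = 0.
  by rewrite -(near_eq_derive _ ln_near) derive_cst.
split; first exact: near_eq_differentiable ln_near _.
  by rewrite L0 D0 mul0r.
by rewrite L0 D0 mulr0.
Qed.

Lemma differentiable_ln_comp x : A x -> differentiable (fun x => ln (p x)) x.
Proof. by move=> Ax; have [] := ln_p_facts 0 Ax. Qed.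

Lemma derive_ln_comp x v : A x -> 'D_v (fun x => ln (p x)) x = 'D_v p x / p x.
Proof. by move=> Ax; have [] := ln_p_facts v Ax. Qed.

Lemma mul_derive_ln_comp x v : A x ->
  p x * 'D_v (fun x => ln (p x)) x = 'D_v p x.
Proof. by move=> Ax; have [] := ln_p_facts v Ax. Qed.

Lemma derive_divergence x v : A x ->
  'D_v (fun x => p x * (ln (p x) - ln (p x0))) x =
  'D_v p x * (ln (p x) - ln (p x0)) + 'D_v p x.
Proof.
move=> Ax; have dx : derivable p x v := diff_derivable (dp Ax).
have dl : derivable (fun x => ln (p x)) x v :=
  diff_derivable (differentiable_ln_comp Ax).
by rewrite (derive_mul_subc _ dx dl) mul_derive_ln_comp.
Qed.

Lemma derive2_divergence v w : differentiable (fun x => 'D_v p x) x0 ->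
  'D_w (fun x => 'D_v (fun x => p x * (ln (p x) - ln (p x0))) x) x0 =
  p x0 * ('D_v (fun x => ln (p x)) x0 * 'D_w (fun x => ln (p x)) x0) +
  'D_w (fun x => 'D_v p x) x0.
Proof.
move=> ddp; have [oA Ax0] := A0.
rewrite -(near_eq_derive (f := fun x => 'D_v p x * (ln (p x) - ln (p x0)) +
  'D_v p x)); last first.
  by apply: open_near oA Ax0 _ => x /derive_divergence ->.
have dl : derivable (fun x => ln (p x)) x0 w :=
  diff_derivable (differentiable_ln_comp Ax0).
have d1 : derivable (fun x => 'D_v p x) x0 w := diff_derivable ddp.
rewrite (derive_mul_subcD _ d1 dl d1) subrr mulr0 add0r.
by rewrite -(mul_derive_ln_comp v Ax0) mulrA.
Qed.

End logarithmic_derivative.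

Section model.
Context {R : realType} {dX dY : measure_display}.
Context {X : measurableType dX} {Y : measurableType dY} {m n : nat}.
Variable S : stat_model R X Y m n.
Local Notation mat := 'M[R]_(m, n).
Local Notation r := (n * m)%N.
Local Notation Px := (input_prob S).
Local Notation nu := (base S).
Implicit Types (Theta : mat) (h : X -> Y -> mat -> R).

Definition joint_integrable h Theta :=
  (Px \x nu)%E.-integrable setT (fun xy => (h xy.1 xy.2 Theta)%:E).

Lemma Pyx_density Theta x :
  has_density nu (Pyx S Theta x) (fun y => dens S x y Theta).
Proof.
split=> [y||B mB]; first exact: cond_dens_ge0.
  exact: measurable_cond_dens.
exact: cond_probE.
Qed.

Lemma iterated_integral_fubini h Theta : joint_integrable h Theta ->
  (\int[Px]_x \int[nu]_y (h x y Theta)%:E =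
   \int[(Px \x nu)%E]_xy (h xy.1 xy.2 Theta)%:E)%E.
Proof. by move=> ih; rewrite -integral12_prod_meas1. Qed.

Lemma iterated_integral_fin_num h Theta : joint_integrable h Theta ->
  (\int[Px]_x \int[nu]_y (h x y Theta)%:E)%E \is a fin_num.
Proof.
by move=> ih; rewrite iterated_integral_fubini//; exact: integrable_fin_num.
Qed.

Lemma eq_integrated h h' Theta : (forall x y, h x y Theta = h' x y Theta) ->
  integrated S h Theta = integrated S h' Theta.
Proof.
move=> hh; rewrite /integrated; congr fine; apply: eq_integral => x _.
by apply: eq_integral => y _; rewrite hh.
Qed.

Lemma integratedD h h' Theta :
  joint_integrable h Theta -> joint_integrable h' Theta ->
  integrated S (fun x y Theta => h x y Theta + h' x y Theta) Theta =
  integrated S h Theta + integrated S h' Theta.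
Proof.
move=> ih ih'; rewrite /integrated.
have ihh : joint_integrable (fun x y Theta => h x y Theta + h' x y Theta) Theta.
  by rewrite /joint_integrable; under eq_fun do rewrite EFinD; exact: integrableD.
rewrite (iterated_integral_fubini ihh) (iterated_integral_fubini ih).
rewrite (iterated_integral_fubini ih') -fineD ?integrable_fin_num//.
by rewrite -(integralD measurableT ih ih'); congr fine; apply: eq_integral => x _; rewrite EFinD.
Qed.

Lemma measurable_section h Theta x : joint_integrable h Theta ->
  measurable_fun setT (fun y => h x y Theta).
Proof.
move=> /(measurable_int _)/measurable_EFinP mh.
exact: (measurableT_comp mh (pair1_measurable x)).
Qed.

Lemma expect_density Theta (g : X -> Y -> R) :
  (forall x, measurable_fun setT (g x)) ->
  expect S Theta g = integrated S (fun x y Theta => dens S x y Theta * g x y) Theta.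
Proof.
move=> mg; rewrite /expect /integrated; congr fine; apply: eq_integral => x _.
by rewrite (integral_density (Pyx_density Theta x)).
Qed.

Lemma eq_expect Theta (g g' : X -> Y -> R) : (forall x y, g x y = g' x y) ->
  expect S Theta g = expect S Theta g'.
Proof.
move=> gg; have -> // : g = g'.
by apply/funext => x; apply/funext => y; exact: gg.
Qed.

Lemma measurable_logdens Theta x :
  measurable_fun setT (fun y => logdens S x y Theta).
Proof.
by apply: measurableT_comp; [exact: measurable_ln|exact: measurable_cond_dens].
Qed.

Lemma PhiE : Phi S =
  (fun Theta => - integrated S
     (fun x y Theta => dens S x y Theta * logdens S x y Theta) Theta).
Proof.
apply/funext => Theta; rewrite /Phi expect_density// => x.
exact: measurable_logdens.
Qed.

Lemma integrated_dens Theta : integrated S (dens S) Theta = 1.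
Proof.
rewrite /integrated (eq_integral (cst 1%E)).
  by rewrite integral_cst// mul1e -[RHS]/(fine 1%E) -(probability_setT Px).
move=> x _; have [_ _ <-//] := Pyx_density Theta x.
by rewrite probability_setT.
Qed.

Variables (Theta0 : mat) (A : set mat).
Hypothesis A0 : open_nbhs Theta0 A.
Hypothesis supp : forall x y Theta, A Theta ->
  (0 < dens S x y Theta <-> 0 < dens S x y Theta0).
Hypothesis reg_dens : Defs.interchange S 2 A (dens S).

Definition divergence x y Theta : R :=
  dens S x y Theta * (logdens S x y Theta - logdens S x y Theta0).

Hypothesis reg_div : Defs.interchange S 2 A divergence.

Let oA : open A. Proof. exact: A0.1. Qed.
Let AT : A Theta0. Proof. exact: A0.2. Qed.

Let d_dens x y Theta : A Theta -> differentiable (dens S x y) Theta.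
Proof. by have [_ [+ _ _ _]] := reg_dens; apply. Qed.

Let dd_dens v x y Theta : A Theta ->
  differentiable (fun Theta => 'D_v (dens S x y) Theta) Theta.
Proof. by have [_ [_ _ _ /(_ v)[_ [+ _ _ _]]]] := reg_dens; apply. Qed.

Let dens_ge0 x y Theta : 0 <= dens S x y Theta.
Proof. exact: cond_dens_ge0. Qed.

Lemma differentiable_logdens x y : differentiable (logdens S x y) Theta0.
Proof.
exact: (differentiable_ln_comp A0 (dens_ge0 x y) (supp x y) (@d_dens x y)).
Qed.

Lemma expected_KL_E Theta : A Theta ->
  expected_KL S Theta Theta0 = (integrated S divergence Theta)%:E.
Proof.
move=> ATh; rewrite /integrated fineK; last first.
  by apply: iterated_integral_fin_num; exact: reg_div.1.
apply: eq_integral => x _.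
exact: (KL_density (Pyx_density Theta x) (Pyx_density Theta0 x)
  (fun y => supp x y ATh)).
Qed.

Lemma integrated_divergence0 : integrated S divergence Theta0 = 0.
Proof.
rewrite /integrated (eq_integral (cst 0%E)) ?integral0// => x _.
by apply: integral0_eq => y _; rewrite /divergence subrr mulr0.
Qed.

Let D_integrated_dens v Theta : A Theta ->
  integrated S (fun x y => 'D_v (dens S x y)) Theta = 0.
Proof.
move=> ATh; have [_ [_ _ <-// _]] := reg_dens.
have -> : integrated S (dens S) = cst 1.
  by apply/funext => Th; rewrite integrated_dens.
exact: derive_cst.
Qed.

Lemma derive_integrated_divergence v :
  'D_v (integrated S divergence) Theta0 = 0.
Proof.
have [_ [_ _ -> // _]] := reg_div.
rewrite -[RHS](D_integrated_dens v AT); apply: eq_integrated => x y.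
rewrite (derive_divergence A0 (dens_ge0 x y) (supp x y) (@d_dens x y))//.
by rewrite subrr mulr0 add0r.
Qed.

Lemma differentiable_integrated_divergence Theta : A Theta ->
  differentiable (integrated S divergence) Theta.
Proof. by have [_ [_ + _ _]] := reg_div; apply. Qed.

Lemma differentiable_derive_integrated_divergence v :
  differentiable (fun Theta => 'D_v (integrated S divergence) Theta) Theta0.
Proof.
have [_ [_ _ DE /(_ v)[_ [_ d _ _]]]] := reg_div.
apply: near_eq_differentiable (d _ AT).
by apply: open_near oA AT _ => Th /DE ->.
Qed.

Lemma measurable_derive_logdens v x :
  measurable_fun setT (fun y => 'D_v (logdens S x y) Theta0).
Proof.
have -> : (fun y => 'D_v (logdens S x y) Theta0) =
    (fun y => 'D_v (dens S x y) Theta0 / dens S x y Theta0).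
  apply/funext => y.
  exact: (derive_ln_comp A0 (dens_ge0 x y) (supp x y) (@d_dens x y)).
apply: measurable_funM.
  have [_ [_ _ _ /(_ v)[iD _]]] := reg_dens.
  have iD' : joint_integrable (fun x y Th => 'D_v (dens S x y) Th) Theta0.
    exact: iD.
  exact: (measurable_section x iD').
apply: measurable_inv_ge0 => //; exact: measurable_cond_dens.
Qed.

Lemma derive2_integrated_divergence v w :
  'D_w (fun Theta => 'D_v (integrated S divergence) Theta) Theta0 =
  expect S Theta0
    (fun x y => 'D_v (logdens S x y) Theta0 * 'D_w (logdens S x y) Theta0).
Proof.
have [_ [_ _ DE /(_ v)[_ [_ _ DDE /(_ w)[iDD _]]]]] := reg_div.
have [_ [_ _ _ /(_ v)[_ [_ _ DDp /(_ w)[iDDp _]]]]] := reg_dens.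
rewrite -(near_eq_derive (f := integrated S (fun x y => 'D_v (divergence x y))));
  last by apply: open_near oA AT _ => Th /DE ->.
rewrite DDE// expect_density; last first.
  by move=> x; apply: measurable_funM; exact: measurable_derive_logdens.
pose g x y Theta := dens S x y Theta *
  ('D_v (logdens S x y) Theta0 * 'D_w (logdens S x y) Theta0).
have DDiv x y : 'D_w ('D_v (divergence x y)) Theta0 =
    g x y Theta0 + 'D_w ('D_v (dens S x y)) Theta0.
  exact: (derive2_divergence A0 (dens_ge0 x y) (supp x y) (@d_dens x y) w
    (dd_dens v x y AT)).
have ig : joint_integrable g Theta0.
  have := integrableB measurableT (iDD _ AT) (iDDp _ AT).
  rewrite /joint_integrable; apply: eq_integrable => // xy _ /=.
  by rewrite DDiv -EFinB addrK.
rewrite (eq_integrated (h' := fun x y Theta => g x y Theta +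
  'D_w ('D_v (dens S x y)) Theta) DDiv) integratedD//; last exact: iDDp.
rewrite -[X in _ + X]DDp//.
rewrite (near_eq_derive (g := cst 0)); last first.
  by apply: open_near oA AT _ => Th; exact: D_integrated_dens.
by rewrite derive_cst addr0.
Qed.

Lemma derive2_integrated_divergenceC v w :
  'D_w (fun Theta => 'D_v (integrated S divergence) Theta) Theta0 =
  'D_v (fun Theta => 'D_w (integrated S divergence) Theta) Theta0.
Proof.
apply: etrans (derive2_integrated_divergence v w) _.
apply: etrans (esym (derive2_integrated_divergence w v)).
by apply: eq_expect => x y; exact: mulrC.
Qed.

End model.

(** * First and second order expansions along a retraction *)

Section rescaled_argmin.
Context {R : realType} {V : normedModType R}.
Implicit Types (C : R -> set V) (f : V -> R).

Lemma near_eq_rescaled_argmin C C' f l :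
  (\forall eps \near 0^'+, C eps = C' eps) ->
  rescaled_argmin_cvg C f l -> rescaled_argmin_cvg C' f l.
Proof. by move=> CC H W /H; apply: filterS2 CC => eps ->. Qed.

Lemma eq_rescaled_argmin C f f' l :
  (forall eps d, C eps d -> f d = f' d) ->
  rescaled_argmin_cvg C f l -> rescaled_argmin_cvg C f' l.
Proof.
move=> ff H W /H; apply: filterS => eps.
have <- : argmin (C eps) f = argmin (C eps) f'.
  apply/seteqP; split=> d [Cd dmin]; split => // d' Cd'.
    by rewrite -(ff _ _ Cd) -(ff _ _ Cd') dmin.
  by rewrite (ff _ _ Cd) (ff _ _ Cd') dmin.
by [].
Qed.

End rescaled_argmin.

Section gradient.
Context {R : realType} {m n : nat}.
Local Notation mat := 'M[R]_(m, n).
Local Notation r := (n * m)%N.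

Lemma dotv_egrad (f : mat -> R) Theta (d : 'cV[R]_r) : differentiable f Theta ->
  dotv (egrad f Theta) d = 'D_(unvec d) f Theta.
Proof.
move=> df; rewrite dotvE (unvec_sum d) derive_lin_sum//.
by apply: eq_bigr => k _; rewrite derive_linZ// mxE mulrC.
Qed.

Lemma first_order_comp (f : mat -> R) (h : mat -> mat) Theta
    (T : set 'cV[R]_r) :
  differentiable f Theta -> h 0 = Theta -> differentiable h 0 ->
  (forall d, T d -> 'D_(unvec d) h 0 = unvec d) ->
  forall e : R, 0 < e -> exists2 rho : R, 0 < rho & forall d, T d ->
    `|d| < rho ->
    `|f (h (unvec d)) - f Theta - dotv (egrad f Theta) d| <= e * `|d|.
Proof.
move=> df h0 dh Dh e e0.
pose C := r%:R * `|egrad f Theta| + 1.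
have C1 : 1 <= C by rewrite lerDr mulr_ge0.
have C0 : 0 < C by exact: lt_le_trans C1.
pose dl := Num.min 1 (e / (2 * C)).
have dl0 : 0 < dl by rewrite lt_min ltr01 divr_gt0// mulr_gt0.
have dl1 : dl <= 1 by rewrite ge_min lexx.
have dlC : dl * C <= e / 2.
  have : dl <= e / (2 * C) by rewrite ge_min lexx orbT.
  by rewrite -(ler_pM2r C0) invfM mulrA divfK// lt0r_neq0.
have [r1 r1_gt0 H1] := differentiable_bound df (divr_gt0 e0 (ltr0n R 4)).
have [r2 r2_gt0 H2] := differentiable_bound dh dl0.
exists (Num.min r2 (r1 / 2)); first by rewrite lt_min r2_gt0 divr_gt0.
move=> d Td; rewrite lt_min => /andP[d2 d1].
pose x := h (unvec d) - Theta.
have hE : h (unvec d) = Theta + x by rewrite /x addrC subrK.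
have xd : `|x - unvec d| <= dl * `|d|.
  have := H2 (unvec d); rewrite norm_unvec => /(_ d2).
  by rewrite add0r h0 Dh.
have nx : `|x| <= 2 * `|d|.
  have := ler_normD (x - unvec d) (unvec d); rewrite subrK norm_unvec.
  have : dl * `|d| <= `|d| by rewrite ler_piMl.
  lra.
have xr1 : `|x| < r1 by lra.
have Hx := H1 x xr1.
have Dx : `|'D_x f Theta - dotv (egrad f Theta) d| <= C * (dl * `|d|).
  have -> : 'D_x f Theta - dotv (egrad f Theta) d =
      dotv (egrad f Theta) (vec (x - unvec d)).
    by rewrite raddfB/= unvecK dotvBr !dotv_egrad// vecK.
  apply: le_trans (dotv_le_norm _ _) _; rewrite -(norm_unvec (vec _)) vecK.
  by rewrite ler_pM ?mulr_ge0// lerDl.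
rewrite hE.
have -> : f (Theta + x) - f Theta - dotv (egrad f Theta) d =
  f (Theta + x) - f Theta - 'D_x f Theta +
  ('D_x f Theta - dotv (egrad f Theta) d) by ring.
apply: le_trans (ler_normD _ _) _.
have : C * (dl * `|d|) <= e / 2 * `|d| by rewrite mulrA (mulrC C) ler_wpM2r.
have : e / 4 * `|x| <= e / 4 * (2 * `|d|) by rewrite ler_wpM2l// divr_ge0// ltW.
lra.
Qed.

Lemma second_order_comp (K : mat -> R) (h : mat -> mat) Theta
    (T : set 'cV[R]_r) (B : 'M[R]_r) :
  (forall e : R, 0 < e -> exists2 rho : R, 0 < rho & forall u : 'cV[R]_r,
    `|u| < rho ->
    `|K (Theta + unvec u) - dotv u (B *m u) / 2| <= e * `|u| ^+ 2) ->
  h 0 = Theta -> differentiable h 0 ->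
  (forall d, T d -> 'D_(unvec d) h 0 = unvec d) ->
  forall e : R, 0 < e -> exists2 rho : R, 0 < rho & forall d, T d ->
    `|d| < rho ->
    `|K (h (unvec d)) - dotv d (B *m d) / 2| <= e * `|d| ^+ 2.
Proof.
move=> KB h0 dh Dh e e0.
have [CB CB0 CBP] := mulmx_bound B.
pose C := r%:R * CB + 1.
have C0 : 0 < C by rewrite ltr_wpDl// mulr_ge0// ltW.
have bilC u v : `|dotv u (B *m v)| <= C * (`|u| * `|v|).
  apply: le_trans (dotv_le_norm _ _) _.
  apply: (@le_trans _ _ (r%:R * `|u| * (CB * `|v|))).
    by rewrite ler_wpM2l// mulr_ge0.
  have -> : r%:R * `|u| * (CB * `|v|) = r%:R * CB * (`|u| * `|v|) by ring.
  by rewrite ler_wpM2r ?mulr_ge0// lerDl.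
pose dl := Num.min 1 (e / (4 * C)).
have dl0 : 0 < dl by rewrite lt_min ltr01 divr_gt0// mulr_gt0.
have dl1 : dl <= 1 by rewrite ge_min lexx.
have dlC : dl * C <= e / 4.
  have : dl <= e / (4 * C) by rewrite ge_min lexx orbT.
  by rewrite -(ler_pM2r C0) invfM mulrA divfK// lt0r_neq0.
have [r1 r1_gt0 H1] := KB _ (divr_gt0 e0 (ltr0n R 8)).
have [r2 r2_gt0 H2] := differentiable_bound dh dl0.
exists (Num.min r2 (r1 / 2)); first by rewrite lt_min r2_gt0 divr_gt0.
move=> d Td; rewrite lt_min => /andP[d2 d1].
pose u := vec (h (unvec d) - Theta); pose s := u - d.
have hE : h (unvec d) = Theta + unvec u by rewrite /u vecK addrC subrK.
have ns : `|s| <= dl * `|d|.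
  have := H2 (unvec d); rewrite norm_unvec => /(_ d2).
  by rewrite add0r h0 Dh// hE (addrC Theta) addrK -raddfB norm_unvec.
have d_ge0 : 0 <= `|d| by [].
have s_ge0 : 0 <= `|s| by [].
have sd : `|s| <= `|d| by rewrite (le_trans ns)// ler_piMl.
have uE : u = d + s by rewrite /s addrC subrK.
have nu : `|u| <= 2 * `|d|.
  by rewrite uE (le_trans (ler_normD _ _))//; lra.
have ur1 : `|u| < r1 by lra.
have := H1 u ur1; rewrite -hE => Hu.
have nu2 : `|u| ^+ 2 <= 4 * `|d| ^+ 2.
  have -> : 4 * `|d| ^+ 2 = (2 * `|d|) ^+ 2 by ring.
  by rewrite ler_sqr ?nnegrE// mulr_ge0.
have bE : dotv u (B *m u) - dotv d (B *m d) =
    dotv d (B *m s) + dotv s (B *m d) + dotv s (B *m s).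
  by rewrite uE mulmxDr !dotvDr !dotvDl; ring.
have bB : `|dotv u (B *m u) - dotv d (B *m d)| <= 3 * (e / 4 * `|d| ^+ 2).
  have step (x y : R) : 0 <= x -> 0 <= y -> x * y <= dl * (`|d| * `|d|) ->
      C * (x * y) <= e / 4 * `|d| ^+ 2.
    move=> x0 y0 xy; apply: (@le_trans _ _ (C * (dl * (`|d| * `|d|)))).
      by rewrite ler_pM2l.
    by rewrite mulrA (mulrC C) -expr2 ler_wpM2r// exprn_ge0.
  have b1 := bilC d s; have b2 := bilC s d; have b3 := bilC s s.
  have s1 : C * (`|d| * `|s|) <= e / 4 * `|d| ^+ 2.
    by apply: step => //; rewrite mulrCA ler_wpM2l.
  have s2 : C * (`|s| * `|d|) <= e / 4 * `|d| ^+ 2.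
    by apply: step => //; rewrite mulrA ler_wpM2r.
  have s3 : C * (`|s| * `|s|) <= e / 4 * `|d| ^+ 2.
    by apply: step => //; rewrite mulrA ler_pM.
  rewrite bE; apply: le_trans (ler_normD _ _) _.
  have := ler_normD (dotv d (B *m s)) (dotv s (B *m d)).
  lra.
have -> : K (h (unvec d)) - dotv d (B *m d) / 2 =
  K (h (unvec d)) - dotv u (B *m u) / 2 +
  (dotv u (B *m u) - dotv d (B *m d)) / 2.
  by rewrite mulrBl addrA subrK.
apply: le_trans (ler_normD _ _) _.
have -> : `|(dotv u (B *m u) - dotv d (B *m d)) / 2| =
  `|dotv u (B *m u) - dotv d (B *m d)| / 2 by rewrite normf_div normr_nat.
have : e / 8 * `|u| ^+ 2 <= e / 8 * (4 * `|d| ^+ 2).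
  by rewrite ler_wpM2l// divr_ge0// ltW.
have : 0 <= e * `|d| ^+ 2 by rewrite mulr_ge0 ?exprn_ge0// ltW.
lra.
Qed.

Lemma symmetric_bilinear_matrix (b : 'cV[R]_r -> 'cV[R]_r -> R) :
  (forall u w, b u w = b w u) ->
  (forall u w, b u w = \sum_j w j 0 * b u (delta_mx j 0)) ->
  exists2 B : 'M[R]_r, B^T = B & forall u w, b u w = dotv u (B *m w).
Proof.
move=> bC bsum; exists (\matrix_(i, j) b (delta_mx i 0) (delta_mx j 0)).
  by apply/matrixP => i j; rewrite !mxE bC.
move=> u w; rewrite bsum dotvE.
transitivity (\sum_j \sum_i u i 0 *
    (b (delta_mx i 0) (delta_mx j 0) * w j 0)).
  apply: eq_bigr => j _; rewrite bC bsum mulr_sumr.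
  by apply: eq_bigr => i _; rewrite (bC (delta_mx j 0)) mulrCA [w j 0 * _]mulrC.
rewrite exchange_big/=; apply: eq_bigr => i _.
by rewrite mxE mulr_sumr; apply: eq_bigr => j _; rewrite mxE.
Qed.

Lemma hessian_matrix (K : mat -> R) Theta :
  (forall v, differentiable (fun x => 'D_v K x) Theta) ->
  (forall v w, 'D_w (fun x => 'D_v K x) Theta =
               'D_v (fun x => 'D_w K x) Theta) ->
  exists2 B : 'M[R]_r, B^T = B & forall u w : 'cV[R]_r,
    'D_(unvec w) (fun x => 'D_(unvec u) K x) Theta = dotv u (B *m w).
Proof.
move=> ddK KC; apply: (@symmetric_bilinear_matrix (fun u w =>
  'D_(unvec w) (fun x => 'D_(unvec u) K x) Theta)) => u w; first exact: KC.
rewrite (unvec_sum w) (derive_lin_sum _ _ (ddK _)).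
by apply: eq_bigr => j _; rewrite (derive_linZ _ _ (ddK _)).
Qed.

Lemma rgrad_derive (M : set mat) (P : 'M[R]_r) (f : mat -> R) Theta i :
  P^T = P -> P *m P = P ->
  (forall u, tangentv M Theta u <-> P *m u = u) ->
  differentiable f Theta ->
  rgrad M f Theta i 0 = 'D_(unvec (P *m delta_mx i 0)) f Theta.
Proof.
move=> Psym PP TP df; rewrite /rgrad (oproj_mulmx Psym PP TP).
by rewrite -dotv_egrad// dotv_mulmx Psym dotv_delta.
Qed.

End gradient.

Theorem theorem3p1 (R : realType) (dX dY : measure_display)
    (X : measurableType dX) (Y : measurableType dY) (m n : nat)
    (S : stat_model R X Y m n) (M : set 'M[R]_(m, n))
    (Rt : 'M[R]_(m, n) -> 'M[R]_(m, n) -> 'M[R]_(m, n))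
    (Theta : 'M[R]_(m, n)) :
  embedded_submanifold M ->
  second_order_retraction M Rt ->
  M Theta ->
  regular_at S Theta ->
  posdef_on (tangentv M Theta) (fisher S M Theta) ->
  rgrad M (Phi S) Theta != 0 ->
  (\forall rho \near 0^'+,
     steepest_descent_in S M Rt Theta [set d | `|d| < rho]) /\
  ((forall W : set 'cV[R]_(n * m), nbhs (0 : 'cV[R]_(n * m)) W ->
      \forall eps \near 0^'+, feasible S M Rt Theta setT eps `<=` W) ->
   steepest_descent_in S M Rt Theta setT).
Proof.
move=> Msub [Rretr _] MT [A A0 [supp regd regpl regdiv]] Fpos g0.
have [oA AT] := A0.
pose T := tangentv M Theta.
have [J TJ] := tangent_kernel Msub MT.
have [P [Psym PP JP]] := exists_orthogonal_projector J.
have TP u : T u <-> P *m u = u by exact: iff_trans (TJ u) (JP u).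
have tanT xi : tangent M Theta xi <-> T (vec xi).
  split=> [txi|[xi' txi' /(congr1 (@unvec R m n))]]; first by exists xi.
  by rewrite !vecK => <-.
have Tunvec d : T d -> tangent M Theta (unvec d).
  by move=> Td; apply/tanT; rewrite unvecK.
have tanZ a xi : tangent M Theta xi -> tangent M Theta (a *: xi).
  by move=> /tanT/TP Txi; apply/tanT/TP; rewrite linearZ/= -scalemxAr Txi.
have tan0 : tangent M Theta 0 by apply/tanT/TP; rewrite linear0 mulmx0.
have [h [rho1 [rho1_gt0 dh hR h0 Dh]]] :=
  retraction_extension Rretr MT tanZ tan0.
have dh0 : differentiable h 0 by apply: dh; rewrite normr0.
have DhT d : T d -> 'D_(unvec d) h 0 = unvec d by move=> /Tunvec /Dh.
have dPhi Th : A Th -> differentiable (Phi S) Th.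
  move=> ATh; rewrite PhiE; apply: differentiableN.
  by have [_ [_ + _ _]] := regpl; apply.
pose K := integrated S (divergence S Theta).
have dK := differentiable_integrated_divergence regdiv.
have ddK := differentiable_derive_integrated_divergence A0 regdiv.
have D2K := derive2_integrated_divergence A0 supp regd regdiv.
have D2C := derive2_integrated_divergenceC A0 supp regd regdiv.
have [B Bsym KBE] := hessian_matrix ddK D2C.
pose F := fisher S M Theta.
have dlog := differentiable_logdens A0 supp regd.
have FE : F = P *m B *m P.
  apply/matrixP => i j; rewrite /F mxE.
  transitivity (dotv (P *m delta_mx i 0) (B *m (P *m delta_mx j 0))).
    apply: etrans (KBE _ _); apply: etrans (esym (D2K _ _)).
    apply: eq_expect => x y; rewrite mxE big_ord1 mxE.
    by congr (_ * _); exact: (rgrad_derive _ Psym PP TP).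
  rewrite -{1}Psym -dotv_mulmx !mulmxA dotvC dotv_delta.
  by rewrite -colE mxE.
have Fsym : F^T = F by rewrite FE !trmx_mul Psym Bsym mulmxA.
have PF : P *m F = F by rewrite FE !mulmxA PP.
have FB d : T d -> dotv d (B *m d) = dotv d (F *m d).
  move=> /TP Td; rewrite FE -!mulmxA Td [in RHS]dotv_mulmx Psym Td//.
pose g := rgrad M (Phi S) Theta.
have gE : g = P *m egrad (Phi S) Theta by exact: (oproj_mulmx Psym PP TP).
have Tg : T g by apply/TP; rewrite gE mulmxA PP.
have [rho2 rho2_gt0 hA] : exists2 rho : R, 0 < rho &
    forall xi, `|xi| < rho -> A (h xi).
  have : nbhs (0 : 'M[R]_(m, n)) [set xi | A (h xi)].
    by apply: (differentiable_continuous dh0); rewrite h0; exact: open_nbhs_nbhs.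
  move=> /nbhs_ballP[rho /= rho0 Hr]; exists rho => // xi xr; apply: Hr.
  by rewrite -ball_normE/= sub0r normrN.
pose rho0 := Num.min rho1 rho2.
have rho0_gt0 : 0 < rho0 by rewrite lt_min rho1_gt0.
pose k (d : 'cV[R]_(n * m)) := K (h (unvec d)).
pose phi (d : 'cV[R]_(n * m)) := Phi S (h (unvec d)).
have cont_comp (f : 'M[R]_(m, n) -> R) (d : 'cV[R]_(n * m)) :
    (forall Th, A Th -> differentiable f Th) -> `|d| < rho0 ->
    {for d, continuous (fun d => f (h (unvec d)))}.
  move=> df; rewrite lt_min -(norm_unvec d) => /andP[d1 d2].
  apply: (continuous_comp (f := fun d => h (unvec d))).
    apply: (continuous_comp (f := @unvec R m n)); first exact: continuous_unvec.
    exact/differentiable_continuous/dh.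
  exact/differentiable_continuous/df/hA.
have k2 : forall e : R, 0 < e -> exists2 rho : R, 0 < rho &
    forall d, T d -> `|d| < rho ->
    `|k d - dotv d (F *m d) / 2| <= e * `|d| ^+ 2.
  move=> e e0.
  have tay := taylor2 A0 dK ddK (integrated_divergence0 S Theta)
    (derive_integrated_divergence A0 supp regd regdiv).
  have KB : forall e1 : R, 0 < e1 -> exists2 rho : R, 0 < rho &
      forall u : 'cV[R]_(n * m), `|u| < rho ->
      `|K (Theta + unvec u) - dotv u (B *m u) / 2| <= e1 * `|u| ^+ 2.
    move=> e1 e1_gt0; have [rho rho_gt0 H] := tay _ e1_gt0.
    by exists rho => // u /H; rewrite KBE.
  have [rho rho_gt0 H] := second_order_comp KB h0 dh0 DhT e0.
  by exists rho => // d Td dr; rewrite -FB//; exact: H.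
have phi1 : forall e : R, 0 < e -> exists2 rho : R, 0 < rho &
    forall d, T d -> `|d| < rho -> `|phi d - phi 0 - dotv g d| <= e * `|d|.
  move=> e e0; have [rho rho_gt0 H] :=
    first_order_comp (dPhi _ AT) h0 dh0 DhT e0.
  exists rho => // d Td dr; rewrite /phi linear0 h0 gE.
  by rewrite (dotv_proj Psym TP)//; exact: H.
have core := rescaled_argmin_quadratic Psym PP TP Fsym PF Fpos Tg g0 rho0_gt0
  (cont_comp _ ^~ dK) (cont_comp _ ^~ dPhi) k2 phi1.
have feasE rho : rho <= rho0 -> feasible S M Rt Theta [set d | `|d| < rho] =
    fun eps => [set d | [/\ `|d| < rho, T d & k d <= eps ^+ 2 / 2]].
  move=> rr; apply/funext => eps; apply/seteqP.
  have KLE d : `|d| < rho -> T d ->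
      expected_KL S (Rt Theta (unvec d)) Theta = (k d)%:E.
    move=> dr Td; have : `|d| < rho0 by exact: lt_le_trans rr.
    rewrite lt_min -(norm_unvec d) => /andP[d1 d2].
    rewrite -(hR _ d1 (Tunvec _ Td)).
    exact: (expected_KL_E supp regdiv (hA _ d2)).
  split=> d [/= dr Td].
    by rewrite KLE// lee_fin => kd; split.
  by move=> kd; split => //=; rewrite KLE// lee_fin.
have local : \forall rho \near 0^'+,
    steepest_descent_in S M Rt Theta [set d | `|d| < rho].
  near=> rho.
  have rr : rho <= rho0 by near: rho; exact: nbhs_right_le.
  rewrite /steepest_descent_in feasE//.
  apply: (@eq_rescaled_argmin _ _ _ phi); last by near: rho; exact: core.
  move=> eps d [dr Td _]; rewrite /phi hR//; last exact: Tunvec.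
  by rewrite norm_unvec (lt_le_trans dr)// (le_trans rr)// ge_min lexx.
split=> // shrink.
have [rho [rho_gt0 srho]] : exists rho : R, 0 < rho /\
    steepest_descent_in S M Rt Theta [set d | `|d| < rho].
  apply: (@filter_ex _ (0 : R)^'+); near=> rho; split.
    by near: rho; exact: nbhs_right_gt.
  by near: rho; exact: local.
apply: near_eq_rescaled_argmin srho.
have : nbhs (0 : 'cV[R]_(n * m)) [set d | `|d| < rho].
  apply/nbhs_ballP; exists rho => //= d; rewrite -ball_normE/= sub0r.
  by rewrite normrN.
move=> /shrink; apply: filterS => eps fW; apply/seteqP; split=> d.
  by case=> _ Td kd.
by move=> fd; have [_ Td kd] := fd; split => //; exact: fW.
Unshelve. all: by end_near. Qed.
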